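(* Let $P$ be a $\mathrm{CHR}_1(C)$ program and $G$ a goal. Let $u$ be the number of distinct constants used in $P$ and $G$, and $w$ the maximal arity of the CHR constraints occurring in $P$ and $G$. Then $G$ has a terminating computation in $P$ if and only if there exists a terminating computation $\delta$ for $G$ in $P$ such that $F_\delta$ is $m$-repetitive with \[m\leq \frac{2^{w(u+w)(w+3)}-1}{2^{w(u+w)}-1}.\]
   Context: $\mathrm{CHR}_1(C)$: Constraint Handling Rules over a signature without function symbols of arity $>0$, with built-in $=$ (plus $true,false$) interpreted as syntactic equality on the Herbrand universe, where every rule has a single head atom: simplification $h\Longleftrightarrow g\mid B$ or propagation $h\Longrightarrow g\mid B$ ($g$ conjunction of built-ins, $B$ multiset of built-in and CHR constraints). Semantics is the abstract semantics $\omega_o$: configurations $\langle G,S,B\rangle_n$; Solve moves a built-in $c$ from the goal into $B$; Introduce moves a CHR constraint $c$ from the goal into the store as $c\#n$ and increments $n$; Apply, for a renamed-apart rule with head $h'$, guard $g$, body $C$ and a store constraint $h\#q$ with matching $\theta$ ($h=h'\theta$, $\mathcal{CT}\models B\rightarrow\exists_{-Fv(B)}(\theta\wedge g)$), adds $C$ to the goal and $\theta$ to $B$, removing $h\#q$ for simplification rules and keeping it for propagation rules. A computation for $G$ starts at $\langle G,\emptyset,true\rangle_1$; it is terminating if it ends in a configuration with built-in store $false$ or with empty goal and no applicable rule. Repetition: an occurrence of $h\#q$ in $\delta$ is its $i$-th repetition $h\#q^i$ if preceded in $\delta$ by $i$ Apply transitions of propagation rules whose heads match $h\#q$. Forest $F_\delta$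 of a terminating computation $\delta$: nodes labeled by repetitions or $\Box$; for each CHR constraint $k$ of the first configuration a tree rooted at $k\#q^0$ ($k\#q$ its identified version); if node labeled $h\#q^i$ is rewritten in $\delta$ by rule $h'\odot g\mid C,k_1,\dots,k_r$ ($C$ built-ins, $k_j$ CHR constraints): for $\odot=\Longrightarrow$ it has $r+1$ children labeled $k_j\#q_j^0$ (the generated repetitions) and $h\#q^{i+1}$; for $\odot=\Longleftrightarrow$ with $r>0$ it has $r$ children $k_j\#q_j^0$; with $r=0$ one child $\Box$. An sc-computation is a root-to-leaf path. Repetitions $h\#q^i,k\#t^j$ are r-equal iff $h=k\rho$ for a renaming $\rho$. An sc-computation $\sigma$ is $p$-repetitive if $p$ is the maximum, over repetitions $x\in\sigma$, of the number of repetitions in $\sigma$ r-equal to $x$. $F_\delta$ is $m$-repetitive if some sc-computation is $m$-repetitive and none is $m'$-repetitive with $m'>m$.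
   Formalization: For a goal without CHR constraints the forest is empty, hence m-repetitive for no m as defined; it is taken to be 0-repetitive. For w = 0 the displayed bound is 0/0; it is read as the geometric sum of 2^{w(u+w)i} for i = 0,...,w+2, which equals 3. *)

(* Defs.v *)
From HB Require Import structures.
From mathcomp Require Import all_boot.
From mathcomp Require Import boolp.

Set Implicit Arguments.
Unset Strict Implicit.
Unset Printing Implicit Defensive.

(** * Syntax of single-headed CHR without function symbols of positive arity *)

(* [Pr] is the type of names of CHR constraints and [C] the type of constants.
   A constraint symbol is a name together with an arity, the latter being the
   number of arguments: p/1 and p/2 are different symbols. *)

Inductive term (C : Type) := Var of nat | Cst of C.
Arguments Var {C}.

Record atom (Pr C : Type) := Atom { name : Pr; args : seq (term C) }.

Inductive builtin (C : Type) := BTrue | BFalse | BEq of term C & term C.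
Arguments BTrue {C}.
Arguments BFalse {C}.

Inductive constr (Pr C : Type) := BI of builtin C | Chr of atom Pr C.
Arguments BI {Pr C}.

(* [is_simp] distinguishes h <=> g | B from h ==> g | B.  Guards are read
   conjunctively; bodies and goals are multisets, kept as sequences so that the
   occurrences of a constraint are told apart by their positions. *)
Record rule (Pr C : Type) := Rule {
  is_simp : bool;
  head : atom Pr C;
  guard : seq (builtin C);
  body : seq (constr Pr C) }.

Section EqTypes.
Variables Pr C : eqType.

Definition term_code (t : term C) : nat + C :=
  match t with Var x => inl x | Cst c => inr c end.
Definition term_decode (t : nat + C) : term C :=
  match t with inl x => Var x | inr c => Cst c end.
Fact term_codeK : cancel term_code term_decode. Proof. by case. Qed.
HB.instance Definition _ := Equality.copy (term C) (can_type term_codeK).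

Definition atom_code (a : atom Pr C) := (name a, args a).
Definition atom_decode (a : Pr * seq (term C)) := Atom a.1 a.2.
Fact atom_codeK : cancel atom_code atom_decode. Proof. by case. Qed.
HB.instance Definition _ := Equality.copy (atom Pr C) (can_type atom_codeK).

Definition builtin_code (b : builtin C) : bool + term C * term C :=
  match b with
  | BTrue => inl true | BFalse => inl false | BEq s t => inr (s, t)
  end.
Definition builtin_decode (b : bool + term C * term C) : builtin C :=
  match b with
  | inl true => BTrue | inl false => BFalse | inr st => BEq st.1 st.2
  end.
Fact builtin_codeK : cancel builtin_code builtin_decode.
Proof. by case. Qed.
HB.instance Definition _ := Equality.copy (builtin C) (can_type builtin_codeK).

Definition constr_code (c : constr Pr C) : builtin C + atom Pr C :=
  match c with BI b => inl b | Chr a => inr a end.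
Definition constr_decode (c : builtin C + atom Pr C) : constr Pr C :=
  match c with inl b => BI b | inr a => Chr a end.
Fact constr_codeK : cancel constr_code constr_decode. Proof. by case. Qed.
HB.instance Definition _ :=
  Equality.copy (constr Pr C) (can_type constr_codeK).

Definition rule_code (r : rule Pr C) := (is_simp r, head r, guard r, body r).
Definition rule_decode
    (r : bool * atom Pr C * seq (builtin C) * seq (constr Pr C)) :=
  Rule r.1.1.1 r.1.1.2 r.1.2 r.2.
Fact rule_codeK : cancel rule_code rule_decode. Proof. by case. Qed.
HB.instance Definition _ := Equality.copy (rule Pr C) (can_type rule_codeK).

End EqTypes.

Section Syntax.
Variables Pr C : eqType.
Implicit Types (a : atom Pr C) (b : builtin C) (c : constr Pr C).
Implicit Types (r : rule Pr C) (P : seq (rule Pr C)) (G : seq (constr Pr C)).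

Definition vars_term (t : term C) : seq nat := if t is Var x then [:: x] else [::].
Definition vars_atom a : seq nat := flatten (map vars_term (args a)).
Definition vars_builtin b : seq nat :=
  if b is BEq s t then vars_term s ++ vars_term t else [::].
Definition vars_constr c : seq nat :=
  match c with BI b => vars_builtin b | Chr a => vars_atom a end.
Definition vars_rule r : seq nat :=
  vars_atom (head r) ++ flatten (map vars_builtin (guard r))
    ++ flatten (map vars_constr (body r)).

Definition csts_term (t : term C) : seq C := if t is Cst c then [:: c] else [::].
Definition csts_atom a : seq C := flatten (map csts_term (args a)).
Definition csts_builtin b : seq C :=
  if b is BEq s t then csts_term s ++ csts_term t else [::].
Definition csts_constr c : seq C :=
  match c with BI b => csts_builtin b | Chr a => csts_atom a end.
Definition csts_rule r : seq C :=
  csts_atom (head r) ++ flatten (map csts_builtin (guard r))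
    ++ flatten (map csts_constr (body r)).

Definition nb_constants P G : nat :=
  size (undup (flatten (map csts_rule P) ++ flatten (map csts_constr G))).

Definition arity a : nat := size (args a).

Definition chr_part G : seq (atom Pr C) :=
  pmap (fun c => if c is Chr a then Some a else None) G.

Definition max_arity P G : nat :=
  maxn (\max_(r <- P) \max_(a <- head r :: chr_part (body r)) arity a)
       (\max_(a <- chr_part G) arity a).

Definition subst_term (s : nat -> term C) (t : term C) : term C :=
  match t with Var x => s x | Cst c => Cst c end.
Definition subst_atom (s : nat -> term C) a : atom Pr C :=
  Atom (name a) (map (subst_term s) (args a)).
Definition subst_builtin (s : nat -> term C) b : builtin C :=
  if b is BEq t1 t2 then BEq (subst_term s t1) (subst_term s t2) else b.
Definition subst_constr (s : nat -> term C) c : constr Pr C :=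
  match c with
  | BI b => BI (subst_builtin s b)
  | Chr a => Chr (subst_atom s a)
  end.

(* A renaming is a permutation [rho] of the variables. *)
Definition ren (rho : nat -> nat) : nat -> term C := fun x => Var (rho x).
Definition ren_rule (rho : nat -> nat) r : rule Pr C :=
  Rule (is_simp r) (subst_atom (ren rho) (head r))
       (map (subst_builtin (ren rho)) (guard r))
       (map (subst_constr (ren rho)) (body r)).

(* The matching [theta], with domain Fv(h), as a conjunction of equations. *)
Definition subst_eqs (h : atom Pr C) (theta : nat -> term C) : seq (builtin C) :=
  [seq BEq (Var x) (theta x) | x <- undup (vars_atom h)].

End Syntax.

(** * Built-in theory: syntactic equality on the Herbrand universe *)

Section Theory.
Variable C : eqType.

(* Without function symbols of positive arity the Herbrand universe is [C]. *)
Definition eval_term (v : nat -> C) (t : term C) : C :=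
  match t with Var x => v x | Cst c => c end.

Definition holds1 (v : nat -> C) (b : builtin C) : bool :=
  match b with
  | BTrue => true
  | BFalse => false
  | BEq s t => eval_term v s == eval_term v t
  end.

Definition holds (v : nat -> C) (B : seq (builtin C)) : bool := all (holds1 v) B.

Definition fv (B : seq (builtin C)) : seq nat := flatten (map (@vars_builtin C) B).

(* CT |= B -> exists_{-Fv(B)} D: every variable of [D] outside Fv(B) is
   existentially quantified, including those of the store constraint. *)
Definition entails (B D : seq (builtin C)) : Prop :=
  forall v, holds v B ->
    exists2 v', {in fv B, v' =1 v} & holds v' D.

Definition inconsistent (B : seq (builtin C)) : Prop := forall v, ~~ holds v B.

End Theory.

(** * The abstract operational semantics *)

Record config (Pr C : Type) := Config {
  goal : seq (constr Pr C);
  store : seq (atom Pr C * nat);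
  bstore : seq (builtin C);
  next : nat }.

(* Goal occurrences are designated by their position.  [Introduce i n] gives the
   identifier [n] to the [i]-th one; [Apply q r] rewrites the constraint with
   identifier [q] by the renamed-apart rule [r]. *)
Inductive step (Pr C : Type) :=
  | Solve of nat
  | Introduce of nat & nat
  | Apply of nat & rule Pr C.
Arguments Solve {Pr C}.
Arguments Introduce {Pr C}.

Section Semantics.
Variables Pr C : eqType.
Implicit Types (P : seq (rule Pr C)) (G : seq (constr Pr C)).
Implicit Types (K : config Pr C) (delta : seq (step Pr C)).

Definition vars_config K : seq nat :=
  flatten (map (@vars_constr Pr C) (goal K))
    ++ flatten (map (fun hq => vars_atom hq.1) (store K)) ++ fv (bstore K).

Definition renamed_apart P K (r : rule Pr C) : Prop :=
  exists rho r0, [/\ bijective rho, r0 \in P, r = ren_rule rho r0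
                   & ~~ has [in vars_config K] (vars_rule r)].

(* The body is put in front of the goal. *)
Inductive trans P : config Pr C -> step Pr C -> config Pr C -> Prop :=
  | trans_solve G1 b G2 S B n :
      trans P (Config (G1 ++ BI b :: G2) S B n) (Solve (size G1))
              (Config (G1 ++ G2) S (b :: B) n)
  | trans_introduce G1 a G2 S B n :
      trans P (Config (G1 ++ Chr a :: G2) S B n) (Introduce (size G1) n)
              (Config (G1 ++ G2) ((a, n) :: S) B n.+1)
  | trans_apply G S1 h q S2 B n r theta :
      renamed_apart P (Config G (S1 ++ (h, q) :: S2) B n) r ->
      h = subst_atom theta (head r) ->
      entails B (subst_eqs (head r) theta ++ guard r) ->
      trans P (Config G (S1 ++ (h, q) :: S2) B n) (Apply q r)
              (Config (body r ++ G)
                      (if is_simp r then S1 ++ S2 else S1 ++ (h, q) :: S2)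
                      (subst_eqs (head r) theta ++ B) n).

Inductive run P : config Pr C -> seq (step Pr C) -> config Pr C -> Prop :=
  | run_nil K : run P K [::] K
  | run_cons K s K' delta K'' :
      trans P K s K' -> run P K' delta K'' -> run P K (s :: delta) K''.

Definition init G : config Pr C := Config G [::] [:: BTrue] 1.

Definition applicable P K : Prop := exists q r K', trans P K (Apply q r) K'.

Definition terminating P G delta : Prop :=
  exists2 K, run P (init G) delta K
    & inconsistent (bstore K) \/ (goal K = [::] /\ ~ applicable P K).

End Semantics.

(** * The forest of a computation and its repetitiveness *)

(* The repetition h#q^i.  The identifier is [None] for a constraint that the
   computation never introduces (possible only if it ends with the built-in
   store false); such a constraint still labels a leaf. *)
Record repetition (Pr C : Type) := Rep {
  rep_constr : atom Pr C;
  rep_id : option nat;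
  rep_index : nat }.

Section RepetitionEqType.
Variables Pr C : eqType.
Definition repetition_code (x : repetition Pr C) :=
  (rep_constr x, rep_id x, rep_index x).
Definition repetition_decode (x : atom Pr C * option nat * nat) :=
  Rep x.1.1 x.1.2 x.2.
Fact repetition_codeK : cancel repetition_code repetition_decode.
Proof. by case. Qed.
HB.instance Definition _ :=
  Equality.copy (repetition Pr C) (can_type repetition_codeK).
End RepetitionEqType.

(* The label [None] is the box. *)
Inductive tree (Pr C : Type) :=
  Node of option (repetition Pr C) & seq (tree Pr C).

Section Forest.
Variables Pr C : eqType.
Implicit Types (a h : atom Pr C) (G : seq (constr Pr C)).
Implicit Types (delta : seq (step Pr C)) (F : seq (tree Pr C)).
Implicit Types (sigma : seq (option (repetition Pr C))).

(* The CHR constraints of [G], each with its position in [G]. *)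
Definition chr_occs G : seq (nat * atom Pr C) :=
  pmap (fun ic => if ic.2 is Chr a then Some (ic.1, a) else None)
       (zip (iota 0 (size G)) G).

(* [occ_tree delta a pos] is the tree of the constraint [a] standing at position
   [pos] of the goal when the steps [delta] remain to be done: its position is
   followed until it is introduced.  [rep_tree delta h q i] is the tree of the
   repetition h#q^i of a stored constraint.  [unbump j pos] is the position of an
   occurrence after the removal of the one at position [j]. *)
Fixpoint occ_tree delta a (pos : nat) {struct delta} : tree Pr C :=
  match delta with
  | [::] => Node (Some (Rep a None 0)) [::]
  | Solve j :: delta' => occ_tree delta' a (unbump j pos)
  | Introduce j n :: delta' =>
      if pos == j then rep_tree delta' a n 0 else occ_tree delta' a (unbump j pos)
  | Apply _ r :: delta' => occ_tree delta' a (size (body r) + pos)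
  end
with rep_tree delta h (q i : nat) {struct delta} : tree Pr C :=
  match delta with
  | [::] => Node (Some (Rep h (Some q) i)) [::]
  | Apply q' r :: delta' =>
      if q' == q then
        let children :=
          [seq occ_tree delta' ka.2 ka.1 | ka <- chr_occs (body r)] in
        Node (Some (Rep h (Some q) i))
          (if ~~ is_simp r then rcons children (rep_tree delta' h q i.+1)
           else if children is [::] then [:: Node None [::]] else children)
      else rep_tree delta' h q i
  | _ :: delta' => rep_tree delta' h q i
  end.

Definition forest G delta : seq (tree Pr C) :=
  [seq occ_tree delta ka.2 ka.1 | ka <- chr_occs G].

Inductive branch : tree Pr C -> seq (option (repetition Pr C)) -> Prop :=
  | branch_leaf l : branch (Node l [::]) [:: l]
  | branch_node l F1 t F2 sigma :
      branch t sigma -> branch (Node l (F1 ++ t :: F2)) (l :: sigma).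

Definition sc_computation F sigma : Prop :=
  exists F1 t F2, F = F1 ++ t :: F2 /\ branch t sigma.

Definition r_equal (x y : repetition Pr C) : Prop :=
  exists2 rho : nat -> nat, bijective rho
    & rep_constr x = subst_atom (@ren C rho) (rep_constr y).

Definition nb_r_equal sigma (x : repetition Pr C) : nat :=
  count (fun y => `[< r_equal y x >]) (pmap id sigma).

Definition sc_repetitive (p : nat) sigma : Prop :=
  (exists2 x, x \in pmap id sigma & nb_r_equal sigma x = p) /\
  (forall x, x \in pmap id sigma -> nb_r_equal sigma x <= p).

(* A maximum over no sc-computation (empty forest) is taken to be 0. *)
Definition forest_repetitive (m : nat) F : Prop :=
  ((exists2 sigma, sc_computation F sigma & sc_repetitive m sigma)
     \/ (F = [::] /\ m = 0)) /\
  (forall m' sigma, m < m' -> sc_computation F sigma -> ~ sc_repetitive m' sigma).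

End Forest.

(* The quotient is exact when 0 < w, being the sum of the powers Q ^ i for
   i < w + 3, where Q = 2 ^ (w * (u + w)).  For w = 0 it would read 0 / 0; then
   Q = 1 and the value of that sum is used instead. *)
Definition repetition_bound (u w : nat) : nat :=
  if w == 0 then 3
  else (2 ^ (w * (u + w) * (w + 3)) - 1) %/ (2 ^ (w * (u + w)) - 1).

(* Main.v *)
From mathcomp Require Import all_boot.
From mathcomp Require Import boolp zify.
Require Import Defs.

Set Implicit Arguments.
Unset Strict Implicit.
Unset Printing Implicit Defensive.

(* Take a terminating computation with the least number of rule applications.  A
   rule application to a constraint h splits the rest of the computation into what
   descends from h and what does not; the two components share only the variables
   of h and communicate through the built-in store, hence only through the set of
   values it allows for these variables.  Such a set is given by equations between
   the variables and the constants of P and G, and can strictly shrink at most w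
   times before becoming empty.  If two applications on one path rewrite r-equal
   constraints and see the same history of these sets, with the same author (inside
   or outside) for each change, then the descendants of the lower one can be run in
   the context of the upper one: this terminates with fewer applications, against
   minimality.  Hence a path has, for each r-equality class, at most one
   application per history.  With Q = 2 ^ (w (u + w)) sets of equations there are at
   most 2 Q ^ (w + 1) histories (the factor 2 is the author of a final failure),
   and one more repetition may stand at the leaf. *)

(** * Renamings *)

Section Renaming.
Variables Pr C : eqType.
Implicit Types (t : term C) (a h : atom Pr C) (b : builtin C) (r : rule Pr C).
Implicit Types (B D : seq (builtin C)) (M : seq (constr Pr C)).
Implicit Types (v : nat -> C) (rho pi : nat -> nat).

Definition ren_bs pi B := map (subst_builtin (ren C pi)) B.
Definition ren_cs pi M := map (subst_constr (ren C pi)) M.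
Definition cvars M : seq nat := flatten (map (@vars_constr Pr C) M).

Lemma cvars_cat M1 M2 : cvars (M1 ++ M2) = cvars M1 ++ cvars M2.
Proof. by rewrite /cvars map_cat flatten_cat. Qed.

Lemma cvars_cons c M : cvars (c :: M) = vars_constr c ++ cvars M.
Proof. by []. Qed.

Lemma fv_cat B1 B2 : fv (B1 ++ B2) = fv B1 ++ fv B2.
Proof. by rewrite /fv map_cat flatten_cat. Qed.

Lemma cvarsP x M :
  reflect (exists2 c, c \in M & x \in vars_constr c) (x \in cvars M).
Proof. exact: flatten_mapP. Qed.

Lemma fvP x B : reflect (exists2 b, b \in B & x \in vars_builtin b) (x \in fv B).
Proof. exact: flatten_mapP. Qed.

Lemma cvars_sub M1 M2 : {subset M1 <= M2} -> {subset cvars M1 <= cvars M2}.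
Proof. by move=> sM x /cvarsP[c cM xc]; apply/cvarsP; exists c; first exact: sM. Qed.

Lemma fv_sub B1 B2 : {subset B1 <= B2} -> {subset fv B1 <= fv B2}.
Proof. by move=> sM x /fvP[c cM xc]; apply/fvP; exists c; first exact: sM. Qed.

Lemma vars_term_ren pi t : vars_term (subst_term (ren C pi) t) = map pi (vars_term t).
Proof. by case: t. Qed.

Lemma vars_atom_ren pi a : vars_atom (subst_atom (ren C pi) a) = map pi (vars_atom a).
Proof.
case: a => p ts; rewrite /vars_atom /= map_flatten -!map_comp.
by congr flatten; apply: eq_map => t /=; rewrite vars_term_ren.
Qed.

Lemma vars_builtin_ren pi b :
  vars_builtin (subst_builtin (ren C pi) b) = map pi (vars_builtin b).
Proof. by case: b => //= s t; rewrite map_cat !vars_term_ren. Qed.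

Lemma vars_constr_ren pi (c : constr Pr C) :
  vars_constr (subst_constr (ren C pi) c) = map pi (vars_constr c).
Proof. by case: c => [b|a] /=; rewrite ?vars_builtin_ren ?vars_atom_ren. Qed.

Lemma fv_ren pi B : fv (ren_bs pi B) = map pi (fv B).
Proof.
rewrite /fv map_flatten -!map_comp; congr flatten.
by apply: eq_map => b /=; rewrite vars_builtin_ren.
Qed.

Lemma cvars_ren pi M : cvars (ren_cs pi M) = map pi (cvars M).
Proof.
rewrite /cvars map_flatten -!map_comp; congr flatten.
by apply: eq_map => b /=; rewrite vars_constr_ren.
Qed.

Lemma vars_rule_ren pi r : vars_rule (ren_rule pi r) = map pi (vars_rule r).
Proof.
rewrite /vars_rule /= !map_cat vars_atom_ren.
by congr (_ ++ (_ ++ _)); [exact: fv_ren | exact: cvars_ren].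
Qed.

Lemma subst_term_comp pi rho t :
  subst_term (ren C pi) (subst_term (ren C rho) t) = subst_term (ren C (pi \o rho)) t.
Proof. by case: t. Qed.

Lemma subst_atom_comp pi rho a :
  subst_atom (ren C pi) (subst_atom (ren C rho) a) = subst_atom (ren C (pi \o rho)) a.
Proof.
case: a => p ts; rewrite /subst_atom /=; congr Atom; rewrite -map_comp.
by apply: eq_map => t /=; rewrite subst_term_comp.
Qed.

Lemma subst_builtin_comp pi rho b :
  subst_builtin (ren C pi) (subst_builtin (ren C rho) b)
  = subst_builtin (ren C (pi \o rho)) b.
Proof. by case: b => //= s t; rewrite !subst_term_comp. Qed.

Lemma subst_constr_comp pi rho (c : constr Pr C) :
  subst_constr (ren C pi) (subst_constr (ren C rho) c)
  = subst_constr (ren C (pi \o rho)) c.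
Proof. by case: c => [b|a] /=; rewrite ?subst_builtin_comp ?subst_atom_comp. Qed.

Lemma ren_rule_comp pi rho r : ren_rule pi (ren_rule rho r) = ren_rule (pi \o rho) r.
Proof.
case: r => s h g bd; rewrite /ren_rule /= subst_atom_comp -!map_comp.
by congr Rule; apply: eq_map => c /=; rewrite ?subst_builtin_comp ?subst_constr_comp.
Qed.

Lemma subst_term_id pi t :
  {in vars_term t, pi =1 id} -> subst_term (ren C pi) t = t.
Proof. by case: t => //= x h; rewrite /ren h ?mem_head. Qed.

Lemma subst_atom_id pi a :
  {in vars_atom a, pi =1 id} -> subst_atom (ren C pi) a = a.
Proof.
case: a => p ts h; rewrite /subst_atom /=; congr Atom; rewrite -[RHS]map_id.
apply/eq_in_map => t tin; apply: subst_term_id => x xt; apply: h.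
by apply/flatten_mapP; exists t.
Qed.

Lemma subst_builtin_id pi b :
  {in vars_builtin b, pi =1 id} -> subst_builtin (ren C pi) b = b.
Proof.
case: b => //= s t h; congr BEq; apply: subst_term_id => x xt; apply: h.
  by rewrite mem_cat xt.
by rewrite mem_cat xt orbT.
Qed.

Lemma subst_constr_id pi (c : constr Pr C) :
  {in vars_constr c, pi =1 id} -> subst_constr (ren C pi) c = c.
Proof. by case: c => [b|a] h /=; rewrite ?subst_builtin_id ?subst_atom_id. Qed.

Lemma ren_bs_id pi B : {in fv B, pi =1 id} -> ren_bs pi B = B.
Proof.
move=> h; rewrite -[RHS]map_id; apply/eq_in_map => b bB; apply: subst_builtin_id.
by move=> x xb; apply: h; apply/fvP; exists b.
Qed.

Lemma ren_cs_id pi M : {in cvars M, pi =1 id} -> ren_cs pi M = M.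
Proof.
move=> h; rewrite -[RHS]map_id; apply/eq_in_map => b bB; apply: subst_constr_id.
by move=> x xb; apply: h; apply/cvarsP; exists b.
Qed.

Lemma map_id_in (s : seq nat) pi : {in s, pi =1 id} -> map pi s = s.
Proof. by move=> h; rewrite -[RHS]map_id; apply/eq_in_map. Qed.

Lemma eval_ren v pi t :
  eval_term v (subst_term (ren C pi) t) = eval_term (v \o pi) t.
Proof. by case: t. Qed.

Lemma holds_ren v pi B : holds v (ren_bs pi B) = holds (v \o pi) B.
Proof. by rewrite /holds all_map; apply: eq_all; case=> //= s t; rewrite !eval_ren. Qed.

Lemma eval_eq v v' t :
  {in vars_term t, v =1 v'} -> eval_term v t = eval_term v' t.
Proof. by case: t => //= x h; rewrite h ?mem_head. Qed.

Lemma holds_eq v v' B : {in fv B, v =1 v'} -> holds v B = holds v' B.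
Proof.
move=> h; apply: eq_in_all => -[] //= s t bB; congr (_ == _);
by apply: eval_eq => x xt; apply: h; apply/fvP; exists (BEq s t) => //=;
  rewrite mem_cat xt ?orbT.
Qed.

Lemma holds_sub v B B' : {subset B' <= B} -> holds v B -> holds v B'.
Proof. by move=> sB /allP h; apply/allP => b /sB /h. Qed.

Lemma subst_eqs_ren pi pi' a (theta : nat -> term C) :
  cancel pi pi' ->
  subst_eqs (subst_atom (ren C pi) a) (fun x => subst_term (ren C pi) (theta (pi' x)))
  = ren_bs pi (subst_eqs a theta).
Proof.
move=> piK; rewrite /subst_eqs vars_atom_ren undup_map_inj; last exact: can_inj piK.
by rewrite /ren_bs -!map_comp; apply: eq_map => x /=; rewrite piK.
Qed.

Lemma match_ren pi pi' a (theta : nat -> term C) :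
  cancel pi pi' ->
  subst_atom (fun x => subst_term (ren C pi) (theta (pi' x))) (subst_atom (ren C pi) a)
  = subst_atom (ren C pi) (subst_atom theta a).
Proof.
move=> piK; case: a => p ts; rewrite /subst_atom /=; congr Atom.
by rewrite -!map_comp; apply: eq_map => -[x|c] //=; rewrite piK.
Qed.

Lemma match_varsP a (theta : nat -> term C) x :
  reflect (exists2 y, y \in vars_atom a & x \in vars_term (theta y))
          (x \in vars_atom (subst_atom theta a)).
Proof.
rewrite /vars_atom; apply: (iffP flatten_mapP).
  case=> t /mapP[[y|c] tin ->] //= xt; exists y => //.
  by apply/flatten_mapP; exists (Var y) => //=; rewrite inE.
case=> y /flatten_mapP[[z|//] zin]; rewrite inE => /eqP-> xt.
by exists (theta z) => //; apply/mapP; exists (Var z).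
Qed.

Lemma fv_subst_eqs a (theta : nat -> term C) :
  fv (subst_eqs a theta) =i vars_atom a ++ vars_atom (subst_atom theta a).
Proof.
move=> x; rewrite mem_cat; apply/fvP/orP.
  case=> b /mapP[y]; rewrite mem_undup => ya -> /=; rewrite inE => /orP[/eqP->|xt].
    by left.
  by right; apply/match_varsP; exists y.
case=> [xa|/match_varsP[y ya xt]].
  exists (BEq (Var x) (theta x)); last by rewrite /= mem_head.
  by apply/mapP; exists x; rewrite ?mem_undup.
exists (BEq (Var y) (theta y)); last by rewrite /= inE xt orbT.
by apply/mapP; exists y; rewrite ?mem_undup.
Qed.

(* [pi] swaps the variables of [[0, n[] outside [I] with those of [[n, 2n[]. *)
Lemma fresh_bij (I X : seq nat) : exists pi,
  [/\ bijective pi, {in I, pi =1 id} & forall x, x \in X -> x \notin I -> pi x \notin X].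
Proof.
pose n := (\max_(x <- I ++ X) x).+1.
have ltn x : x \in I ++ X -> x < n by move=> xI; rewrite ltnS; exact: leq_bigmax_seq.
pose pi x := if x < n then (if x \in I then x else x + n)
             else if x < n + n then (if x - n \in I then x else x - n) else x.
have piK : cancel pi pi.
  move=> x; rewrite /pi; case: (ltnP x n) => xn.
    have [xI|xI] := boolP (x \in I); first by rewrite xn xI.
    by rewrite ltnNge leq_addl /= ltn_add2r xn addnK (negbTE xI).
  case: (ltnP x (n + n)) => xnn; last by rewrite ltnNge xn /= ltnNge xnn.
  have [xI|xI] := boolP (x - n \in I); first by rewrite ltnNge xn /= xnn xI.
  have -> : x - n < n by rewrite ltn_subLR.
  by rewrite (negbTE xI) subnK.
exists pi; split; first by exists pi.
  by move=> x xI; rewrite /pi ltn ?mem_cat ?xI.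
move=> x xX xI; rewrite /pi ltn ?mem_cat ?xX ?orbT // (negbTE xI).
apply/negP => xnX; have := ltn (x + n); rewrite mem_cat xnX orbT => /(_ isT).
by rewrite ltnNge leq_addl.
Qed.

End Renaming.

(** * Interface states and their histories *)

Section States.
Variables (C : eqType) (c0 : C).
Implicit Types (B : seq (builtin C)) (I : seq nat) (S : seq C -> Prop).
Implicit Types (H : seq (bool * (seq C -> Prop))).

(** States are sets of tuples indexed by the positions in [I], not by variables, so that the states
    of r-equal constraints can be compared directly. *)
Definition proj I B : seq C -> Prop := fun s => exists2 v, holds v B & s = map v I.

Definition bcsts B : seq C := flatten (map (@csts_builtin C) B).

Lemma bcsts_cons b B : bcsts (b :: B) = csts_builtin b ++ bcsts B.
Proof. by []. Qed.

Lemma bcsts_cat B1 B2 : bcsts (B1 ++ B2) = bcsts B1 ++ bcsts B2.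
Proof. by rewrite /bcsts map_cat flatten_cat. Qed.

(** Without function symbols of positive arity, deduction from equations is mere equivalence
    closure. *)
Inductive conn B : term C -> term C -> Prop :=
  | conn_eq s t : BEq s t \in B -> conn B s t
  | conn_refl t : conn B t t
  | conn_sym s t : conn B s t -> conn B t s
  | conn_trans s t r : conn B s t -> conn B t r -> conn B s r.

Lemma conn_holds B s t v : conn B s t -> holds v B -> eval_term v s = eval_term v t.
Proof.
move=> st hB; elim: st => //.
  by move=> s' t' /(allP hB) /= /eqP.
by move=> s' t' r' _ -> _ ->.
Qed.

Lemma conn_csts B s t :
  conn B s t -> s = t \/ {subset csts_term s ++ csts_term t <= bcsts B}.
Proof.
elim.
- move=> s' t' st; right=> c cin; apply/flatten_mapP; exists (BEq s' t') => //.
- by left.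
- move=> s' t' _ [->|h]; first by left.
  by right=> c; rewrite mem_cat orbC -mem_cat; exact: h.
- move=> s' t' r' _ [->|h] // _ [<-|h']; first by right.
  right=> c; rewrite mem_cat => /orP[cs|cr].
    by apply: h; rewrite mem_cat cs.
  by apply: h'; rewrite mem_cat cr orbT.
Qed.

Variable U : seq C.

Definition nonempty S := exists s, S s.
Definition sized k S := forall s, S s -> size s = k.

Definition same S i j := forall s, S s -> nth c0 s i = nth c0 s j.
Definition fixed S i c := forall s, S s -> nth c0 s i = c.

(** A nonempty [S] must contain every solution of the equations it satisfies, so these equations
    determine it. The empty set satisfies contradictory equations and is set apart. *)
Definition eqclosed k S : Prop :=
  nonempty S -> forall s, size s = k ->
  (forall i j, i < k -> j < k -> same S i j -> nth c0 s i = nth c0 s j) ->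
  (forall i c, i < k -> c \in U -> fixed S i c -> nth c0 s i = c) -> S s.

Lemma sized_proj I B : sized (size I) (proj I B).
Proof. by move=> s [v _ ->]; rewrite size_map. Qed.

(** A tuple meeting the equations valid on the projection extends to a solution of [B]: a class of
    [conn] that meets the interface or contains a constant has a forced value, unambiguous because
    the tuple respects these equations, and the other classes are free. *)
Lemma proj_eqclosed I B :
  {subset bcsts B <= U} -> eqclosed (size I) (proj I B).
Proof.
move=> BU [s0 [v0 v0B _]] s sk hs hc.
have projI v : holds v B -> proj I B (map v I) by move=> vB; exists v.
pose x0 := 0.
have nI v i : i < size I -> nth c0 (map v I) i = v (nth x0 I i).
  by move=> iI; rewrite (nth_map x0).
(* [R t d]: the class of [t] forces the value [d]. *)
pose R t d := (exists2 i, i < size I /\ conn B t (Var (nth x0 I i)) & d = nth c0 s i)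
              \/ conn B t (Cst d).
have samei i j : i < size I -> j < size I ->
    conn B (Var (nth x0 I i)) (Var (nth x0 I j)) -> nth c0 s i = nth c0 s j.
  move=> iI jI cij; apply: hs => // s' [v vB ->]; rewrite !nI //.
  exact: conn_holds cij vB.
have fixi i c : i < size I -> conn B (Var (nth x0 I i)) (Cst c) -> nth c0 s i = c.
  move=> iI cic; apply: hc => //.
    by case: (conn_csts cic) => // h; apply: BU; apply: h; rewrite mem_cat mem_head orbT.
  by move=> s' [v vB ->]; rewrite nI //; exact: conn_holds cic vB.
have Rfun t d d' : R t d -> R t d' -> d = d'.
  case=> [[i [iI ti] ->]|td]; case=> [[j [jI tj] ->]|td'].
  - by apply: samei => //; apply: conn_trans (conn_sym ti) tj.
  - by apply: fixi => //; apply: conn_trans (conn_sym ti) td'.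
  - by symmetry; apply: fixi => //; apply: conn_trans (conn_sym tj) td.
  - exact: (conn_holds (conn_trans (conn_sym td) td') v0B).
have Rconn t t' d : conn B t t' -> R t d -> R t' d.
  move=> /conn_sym tt' [[i [iI ti] ->]|td].
    by left; exists i => //; split=> //; apply: conn_trans ti.
  by right; apply: conn_trans td.
(* Unforced terms all receive the same [c0], which satisfies every equation between them. *)
pose v x := if pselect (exists d, R (Var x) d) is left h then projT1 (cid h) else c0.
have vR t d : R t d -> eval_term v t = d.
  case: t => [x|c] Rd /=; last by apply: Rfun Rd; right; exact: conn_refl.
  rewrite /v; case: pselect => [h|[]]; last by exists d.
  exact: Rfun (projT2 (cid h)) Rd.
exists v.
  apply/allP => -[] //=.
  - by move=> fB; have := allP v0B _ fB.
  move=> t t' ttB; have tt := conn_eq ttB; apply/eqP.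
  have [[d Rd]|nR] := pselect (exists d, R t d).
    by rewrite (vR _ _ Rd) (vR _ _ (Rconn _ _ _ tt Rd)).
  have nR' : ~ exists d, R t' d.
    by move=> [d Rd]; apply: nR; exists d; apply: Rconn Rd; apply: conn_sym.
  case: t nR {ttB tt} => [x|c] nR; last by case: nR; exists c; right; exact: conn_refl.
  case: t' nR' => [x'|c] nR'; last by case: nR'; exists c; right; exact: conn_refl.
  by rewrite /= /v; case: pselect => // _; case: pselect.
apply: (@eq_from_nth _ c0); rewrite ?size_map // => i; rewrite sk => iI.
rewrite nI //; symmetry; apply: (vR (Var _)); left; exists i => //; split=> //.
exact: conn_refl.
Qed.

(* The rank counts the coordinates that [S] leaves free: those equal neither to a
   constant of [U] nor to an earlier coordinate. *)
Definition determined S i :=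
  (exists2 c, c \in U & fixed S i c) \/ (exists2 j, j < i & same S i j).

Definition rank k S := count (fun i => ~~ `[< determined S i >]) (iota 0 k).

Lemma determined_sub S S1 i :
  (forall s, S1 s -> S s) -> determined S i -> determined S1 i.
Proof.
move=> sS [[c cU h]|[j ji h]]; first by left; exists c => // s /sS /h.
by right; exists j => // s /sS /h.
Qed.

(** Following equalities towards earlier coordinates must stop, at a constant or at a free
    coordinate. *)
Lemma determined_rep S i :
  (exists2 c, c \in U & fixed S i c)
  \/ (exists2 f, f <= i & ~ determined S f /\ same S i f).
Proof.
have [n] := ubnP i; elim: n i => // n IH i; rewrite ltnS => lei.
have [[//|[j ji sij]]|nd] := pselect (determined S i); first by left.
  case: (IH j) => [|[c cU fj]|[f fj [nf sjf]]]; first exact: leq_trans lei.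
    by left; exists c => // s Ss; rewrite sij // fj.
  right; exists f; first by rewrite (leq_trans fj) // ltnW.
  by split=> // s Ss; rewrite sij // sjf.
by right; exists i.
Qed.

(** With equal ranks, the free coordinates of [S] would stay free in [S1]. Every coordinate reduces
    on [S] to a constant or to a free coordinate, so an equation holding on [S1] but not on [S]
    would determine one of the free ones. Hence both satisfy the same equations, and closure of [S1]
    gives equality. *)
Lemma rank_strict k S S1 :
  (forall s, S1 s -> S s) -> S1 <> S -> sized k S -> nonempty S1 -> eqclosed k S1 ->
  rank k S1 < rank k S.
Proof.
move=> sS neS szS neS1 clS1.
have subd i : ~~ `[< determined S1 i >] -> ~~ `[< determined S i >].
  by move=> /asboolPn nd; apply/asboolPn => /(determined_sub sS).
have le1 : rank k S1 <= rank k S by apply: sub_count => i; exact: subd.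
rewrite ltn_neqAle le1 andbT; apply/eqP => eqr; apply: neS.
have [s1 Ss1] := neS1.
have eqd i : i < k -> determined S1 i -> determined S i.
  move=> ik d1; apply: contrapT => nd.
  suff : rank k S1 < rank k S by rewrite eqr ltnn.
  (* Splitting the count at [i], where [S1] loses a free coordinate, makes the inequality strict. *)
  have -> : rank k = fun S => count (fun i => ~~ `[< determined S i >])
                               (iota 0 i ++ i :: iota i.+1 (k - i.+1)).
    apply/funext => T; rewrite /rank -[k in LHS](subnKC (ltnW ik)) iotaD add0n.
    by case: (k - i) (subnSK ik) => [|m]; rewrite ?subSS //= => -[->].
  rewrite !count_cat /=.
  have -> : ~~ `[< determined S1 i >] = false by apply/negbF/asboolP.
  have -> : ~~ `[< determined S i >] by apply/asboolPn.
  have := sub_count subd (iota 0 i); have := sub_count subd (iota i.+1 (k - i.+1)).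
  by lia.
apply/funext => s; apply/propext; split=> [/sS //|Ss].
apply: clS1 => //; first exact: szS.
  move=> i j ik jk sij.
  case: (determined_rep S i) => [[c cU fi]|[f fi [nf sif]]];
  case: (determined_rep S j) => [[c' cU' fj]|[f' fj [nf' sjf]]].
  - by rewrite fi // fj // -(fi s1 (sS _ Ss1)) -(fj s1 (sS _ Ss1)); exact: sij.
  - case: nf'; apply: eqd; first exact: leq_ltn_trans jk.
    left; exists c => // s' Ss'.
    by rewrite -sjf -?sij ?fi //; apply: sS.
  - case: nf; apply: eqd; first exact: leq_ltn_trans ik.
    left; exists c' => // s' Ss'.
    by rewrite -sif ?sij ?fj //; apply: sS.
  - rewrite sif // sjf //.
    have sff : same S1 f f'.
      by move=> s' Ss'; rewrite -sif -?sjf -?sij //; exact: sS.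
    case: (ltngtP f f') => [lt|gt|-> //].
      case: nf'; apply: eqd; first exact: leq_ltn_trans jk.
      by right; exists f => // s' /sff.
    case: nf; apply: eqd; first exact: leq_ltn_trans ik.
    by right; exists f'.
move=> i c ik cU fic.
case: (determined_rep S i) => [[c' cU' fi]|[f fi [nf sif]]].
  by rewrite fi // -(fi s1 (sS _ Ss1)); exact: fic.
case: nf; apply: eqd; first exact: leq_ltn_trans ik.
by left; exists c => // s' Ss'; rewrite -sif ?fic //; exact: sS.
Qed.

(* A history records the strict shrinkings of a state, each with its author. *)
Fixpoint chain k S H : Prop :=
  if H is (o, S1) :: H1 then
    [/\ forall s, S1 s -> S s, S1 <> S, eqclosed k S1 & chain k S1 H1]
  else True.

Definition last_state S H := last S (map snd H).
Definition all_nonempty H := forall x, x \in map snd H -> nonempty x.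

Lemma chain_size k S H :
  sized k S -> chain k S H -> all_nonempty H -> size H <= rank k S.
Proof.
elim: H S => //= -[o S1] H IH S szS [sS neS cl ch] aH.
have neS1 : nonempty S1 by apply: aH; rewrite mem_head.
apply: leq_ltn_trans (rank_strict sS neS szS neS1 cl).
apply: IH => //; first by move=> s /sS /szS.
by move=> x xH; apply: aH; rewrite inE xH orbT.
Qed.

Lemma rank_le k S : rank k S <= k.
Proof. by rewrite -[leqRHS](size_iota 0) count_size. Qed.
End States.

(** * Histories as words over a finite alphabet *)

Section Codes.
Variables (C : eqType) (c0 : C) (U : seq C) (w k : nat).
Hypothesis kw : k <= w.
Implicit Types (S : seq C -> Prop) (H : seq (bool * (seq C -> Prop))).

Definition letter : finType := {ffun 'I_w * ('I_(size U) + 'I_w) -> bool}.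

(* The diagonal, being the set of trivial equations, is free to carry [f]. *)
Definition encode (f : nat -> bool) S : letter :=
  [ffun p : 'I_w * ('I_(size U) + 'I_w) => match p.2 with
   | inl c => `[< fixed c0 S p.1 (nth c0 U c) >]
   | inr j => if p.1 == j then f j else `[< same c0 S p.1 j >]
   end].

(** Only the bits off the diagonal and at coordinates below [k] are used. They tell which equations
    hold, and the closed set [S'] contains every tuple satisfying those that hold on it. *)
Lemma encode_sub f f' S S' :
  sized k S -> nonempty S' -> eqclosed c0 U k S' ->
  encode f S = encode f' S' -> forall s, S s -> S' s.
Proof.
move=> szS ne cl eqc s Ss; apply: cl => //; first exact: szS.
  move=> i j ik jk sij; have [->//|nij] := eqVneq i j.
  have iw := leq_trans ik kw; have jw := leq_trans jk kw.
  move/ffunP/(_ (Ordinal iw, inr (Ordinal jw))): eqc.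
  rewrite !ffunE /= -val_eqE /= (negbTE nij).
  move=> e; have /asboolP : `[< same c0 S i j >] by rewrite e; apply/asboolP.
  exact.
move=> i c ik cU fic.
have iw := leq_trans ik kw; have cs : index c U < size U by rewrite index_mem.
move/ffunP/(_ (Ordinal iw, inl (Ordinal cs))): eqc.
rewrite !ffunE /= nth_index // => e.
have /asboolP : `[< fixed c0 S i c >] by rewrite e; apply/asboolP.
exact.
Qed.

Lemma encode_inj f f' S S' :
  sized k S -> sized k S' -> nonempty S -> nonempty S' ->
  eqclosed c0 U k S -> eqclosed c0 U k S' -> encode f S = encode f' S' ->
  S = S' /\ forall i, i < w -> f i = f' i.
Proof.
move=> sz sz' ne ne' cl cl' e; split.
  by apply/funext => s; apply/propext; split;
    [exact: encode_sub e s | exact: encode_sub (esym e) s].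
move=> i iw; move/ffunP/(_ (Ordinal iw, inr (Ordinal iw))): e.
by rewrite !ffunE /= eqxx.
Qed.

(** Padding repeats the current state. A recorded change is strict and never repeats it, so the end
    of the history can be read off the word. *)
Fixpoint pad n S H : seq letter :=
  if n is n'.+1 then
    if H is (o, S1) :: H1 then encode (fun=> o) S1 :: pad n' S1 H1
    else encode (fun=> false) S :: pad n' S [::]
  else [::].

Lemma size_pad n S H : size (pad n S H) = n.
Proof. by elim: n S H => //= n IH S [|[o S1] H1] /=; rewrite IH. Qed.

Lemma pad_inj n S H H' : n <= w -> sized k S -> nonempty S -> eqclosed c0 U k S ->
  chain c0 U k S H -> chain c0 U k S H' -> all_nonempty H -> all_nonempty H' ->
  size H <= n -> size H' <= n -> pad n S H = pad n S H' -> H = H'.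
Proof.
elim: n S H H' => [|n IH] S [|[o S1] H] [|[o' S1'] H'] //= nw szS neS clS.
- move=> _ [sS nS cl _] _ ne' _ _ [e _]; case: nS.
  have ne1 : nonempty S1' by apply: ne'; rewrite mem_head.
  by case: (encode_inj _ _ _ _ _ _ e) => // s /sS /szS.
- move=> [sS nS cl _] _ ne' _ _ _ [e _]; case: nS.
  have ne1 : nonempty S1 by apply: ne'; rewrite mem_head.
  by case: (encode_inj _ _ _ _ _ _ e) => // s /sS /szS.
move=> [sS nS cl ch] [sS' nS' cl' ch'] ne ne' sz sz' [e ep].
have ne1 : nonempty S1 by apply: ne; rewrite mem_head.
have ne1' : nonempty S1' by apply: ne'; rewrite mem_head.
have sz1 : sized k S1 by move=> s /sS /szS.
have sz1' : sized k S1' by move=> s /sS' /szS.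
have [eS eo] := encode_inj sz1 sz1' ne1 ne1' cl cl' e.
rewrite (eo 0 (leq_trans (ltn0Sn n) nw)); case: _ / eS in cl' ch' ep {e eo nS' sS' ne1' sz1'} ne' *.
congr (_ :: _); apply: (IH S1) => //; first exact: ltnW.
  by move=> x xH; apply: ne; rewrite inE xH orbT.
by move=> x xH; apply: ne'; rewrite inE xH orbT.
Qed.

Definition empty_state : seq C -> Prop := fun=> False.

(** Letters are faithful on nonempty states only, so a final empty state is cut off and only its
    author is kept. Whether there is one is a property [fl] of the whole computation, shared by all
    its nodes. *)
Definition closing (fl tag : bool) : seq (bool * (seq C -> Prop)) :=
  if fl then [:: (tag, empty_state)] else [::].

(* No state strictly shrinks the empty one, so only the last state of a history
   can be empty. *)
Lemma chain_closing fl S H : nonempty S -> chain c0 U k S H ->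
  (nonempty (last_state S H) <-> ~~ fl) ->
  exists tag H0, [/\ H = H0 ++ closing fl tag, all_nonempty H0 & chain c0 U k S H0].
Proof.
elim: H S => [|[o S1] H IH] S neS /=.
  rewrite /last_state /= => _ [/(_ neS) nfl _]; exists true, [::].
  by rewrite /closing (negbTE nfl).
move=> [sS nS cl ch] lastE; have [ne1|e1] := pselect (nonempty S1).
  have [tag [H0 [-> ne0 ch0]]] := IH S1 ne1 ch lastE.
  exists tag, ((o, S1) :: H0); split=> //= x; rewrite inE => /orP[/eqP-> //|].
  exact: ne0.
have S1E : S1 = empty_state.
  by apply/funext => s; apply/propext; split=> // Ss; apply: e1; exists s.
have HE : H = [::].
  case: H ch {IH lastE} => // -[o' S2] H /= [sS2 nS2 _ _]; case: nS2.
  by apply/funext => s; apply/propext; split=> [/sS2 //|]; rewrite S1E.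
move: lastE; rewrite /last_state HE /= => lastE.
have flE : fl by apply: contrapT => /negP /lastE.
by exists o, [::]; rewrite /closing flE S1E.
Qed.

Definition code : finType := (bool * letter * w.-tuple letter)%type.

Lemma card_code : #|code| = 2 * 2 ^ (w * (size U + w)) * (2 ^ (w * (size U + w))) ^ w.
Proof. by rewrite !card_prod card_tuple card_bool card_ffun card_prod card_sum !card_ord card_bool. Qed.

Definition coded fl S (f : nat -> bool) H (x : code) : Prop :=
  exists tag H0 (sz : size (pad w S H0) == w),
    [/\ H = H0 ++ closing fl tag, all_nonempty H0, chain c0 U k S H0, size H0 <= w
      & x = (tag, encode f S, Tuple sz)].

Lemma coded_exists fl S f H :
  sized k S -> nonempty S -> chain c0 U k S H ->
  (nonempty (last_state S H) <-> ~~ fl) -> exists x, coded fl S f H x.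
Proof.
move=> szS neS ch lastE.
have [tag [H0 [eH ne0 ch0]]] := chain_closing neS ch lastE.
have sz : size (pad w S H0) == w by rewrite size_pad.
exists (tag, encode f S, Tuple sz), tag, H0, sz; split=> //.
exact: leq_trans (chain_size szS ch0 ne0) (leq_trans (rank_le _ _ _ _) kw).
Qed.

Lemma coded_inj fl S S' f f' H H' x :
  sized k S -> sized k S' -> nonempty S -> nonempty S' ->
  eqclosed c0 U k S -> eqclosed c0 U k S' ->
  coded fl S f H x -> coded fl S' f' H' x ->
  [/\ S = S', H = H' & forall i, i < w -> f i = f' i].
Proof.
move=> sz sz' ne ne' cl cl' [tag [H0 [szp [-> ne0 ch0 le0 ->]]]].
move=> [tag' [H0' [szp' [-> ne0' ch0' le0' [<- e /= ep]]]]].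
have [eS ef] := encode_inj sz sz' ne ne' cl cl' e.
case: _ / eS in ch0' ep *; split=> //.
by rewrite (pad_inj _ sz ne cl ch0 ch0' ne0 ne0' _ _ ep).
Qed.

End Codes.

(** * Components *)

Section Components.
Variables (Pr C : eqType) (P : seq (rule Pr C)).
Implicit Types (a h : atom Pr C) (r : rule Pr C) (I : seq nat).
Implicit Types (B D : seq (builtin C)) (M : seq (constr Pr C)).
Implicit Types (S : seq C -> Prop) (H : seq (bool * (seq C -> Prop))).
Implicit Types (K : config Pr C).

(* Entailment seen by a component with built-in store [B], when the other
   component is known only through the interface variables [I] and the set [S] of
   values that the whole store allows for them. *)
Definition centails I B S D : Prop :=
  forall v, holds v B -> S (map v I) ->
    exists2 v', {in I ++ fv B, v' =1 v} & holds v' D.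

Definition variant r : Prop := exists rho r0, [/\ bijective rho, r0 \in P & r = ren_rule rho r0].

(** Freshness is asked with respect to this component and the interface only, since the rest of the
    configuration is unknown here; [fires_fresh] supplies it later by renaming. *)
Definition fires I S M B h r theta : Prop :=
  [/\ variant r, ~~ has [in I ++ cvars M ++ fv B] (vars_rule r),
      h = subst_atom theta (head r)
    & centails I B S (subst_eqs (head r) theta ++ guard r)].

Definition residue h r : seq (constr Pr C) :=
  body r ++ (if is_simp r then [::] else [:: Chr h]).

(** Goal and store are merged into one multiset, so Introduce is invisible. The number is that of
    rule applications made by the step. *)
Inductive cstep I S : seq (constr Pr C) -> seq (builtin C) -> nat ->
    seq (constr Pr C) -> seq (builtin C) -> Prop :=
  | cstep_solve M b M0 B : perm_eq M (BI b :: M0) -> cstep I S M B 0 M0 (b :: B)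
  | cstep_apply M h M0 B r theta :
      perm_eq M (Chr h :: M0) -> fires I S M B h r theta ->
      cstep I S M B 1 (residue h r ++ M0) (subst_eqs (head r) theta ++ B).

Definition cinert I S M B : Prop :=
  (forall b, BI b \notin M) /\
  (forall h r theta, Chr h \in M -> ~ fires I S M B h r theta).

(* [ctrace I n M B S H]: from the state [(M, B)], the component can reach its end
   with [n] rule applications while the interface state undergoes the history [H],
   in which [true] marks its own changes. *)
Inductive ctrace I : nat -> seq (constr Pr C) -> seq (builtin C) ->
    (seq C -> Prop) -> seq (bool * (seq C -> Prop)) -> Prop :=
  | ct_fail M B S : ~ nonempty S -> ctrace I 0 M B S [::]
  | ct_done M B S : cinert I S M B -> ctrace I 0 M B S [::]
  | ct_silent M B S H j n M1 B1 : cstep I S M B j M1 B1 ->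
      (forall s, S s -> proj I B1 s) -> ctrace I n M1 B1 S H ->
      ctrace I (j + n) M B S H
  | ct_own M B S H j n M1 B1 S1 : cstep I S M B j M1 B1 ->
      (forall s, S1 s <-> S s /\ proj I B1 s) -> ctrace I n M1 B1 S1 H ->
      ctrace I (j + n) M B S ((true, S1) :: H)
  | ct_env M B S H n S1 : ctrace I n M B S1 H -> ctrace I n M B S ((false, S1) :: H).

Lemma variant_ren pi r : bijective pi -> variant r -> variant (ren_rule pi r).
Proof.
move=> bpi [rho [r0 [brho r0P ->]]]; exists (pi \o rho), r0; split=> //.
  exact: bij_comp.
by rewrite ren_rule_comp.
Qed.

Lemma proj_ren pi I B : bijective pi -> proj (map pi I) (ren_bs pi B) = proj I B.
Proof.
move=> [pi' piK pi'K]; apply/funext => s; apply/propext; split=> -[v vB ->].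
  exists (v \o pi); first by rewrite -holds_ren.
  by rewrite map_comp.
exists (v \o pi'); last by rewrite -map_comp; apply: eq_map => x /=; rewrite piK.
by rewrite holds_ren (holds_eq (v' := v)) // => x _ /=; rewrite piK.
Qed.

Lemma centails_ren pi I B S D : bijective pi -> centails I B S D ->
  centails (map pi I) (ren_bs pi B) S (ren_bs pi D).
Proof.
move=> [pi' piK pi'K] ent v; rewrite holds_ren -map_comp => vB Sv.
have [v' vv' v'D] := ent _ vB Sv; exists (v' \o pi').
  rewrite fv_ren -map_cat => _ /mapP[x xin ->] /=.
  by rewrite piK vv'.
by rewrite holds_ren (holds_eq (v' := v')) // => x _ /=; rewrite piK.
Qed.

Lemma fires_ren pi pi' I S M B h r theta : cancel pi pi' -> cancel pi' pi ->
  fires I S M B h r theta ->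
  fires (map pi I) S (ren_cs pi M) (ren_bs pi B) (subst_atom (ren C pi) h)
        (ren_rule pi r) (fun x => subst_term (ren C pi) (theta (pi' x))).
Proof.
move=> piK pi'K [vr fr hE ent]; have bpi : bijective pi by exists pi'.
split.
- exact: variant_ren.
- rewrite vars_rule_ren fv_ren cvars_ren -!map_cat has_map.
  apply: contra fr => /hasP[x xr /= xin]; apply/hasP; exists x => //=.
  by move: xin; rewrite mem_map //; exact: can_inj piK.
- by rewrite /= (match_ren _ _ piK) -hE.
rewrite /= (subst_eqs_ren _ _ piK) -/(ren_bs pi (guard r)) -map_cat.
exact: centails_ren.
Qed.

Lemma residue_ren pi h r :
  ren_cs pi (residue h r) = residue (subst_atom (ren C pi) h) (ren_rule pi r).
Proof. by rewrite /residue /ren_cs map_cat /=; case: (is_simp r). Qed.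

Lemma cstep_ren pi I S M B n M1 B1 : bijective pi -> cstep I S M B n M1 B1 ->
  cstep (map pi I) S (ren_cs pi M) (ren_bs pi B) n (ren_cs pi M1) (ren_bs pi B1).
Proof.
move=> bpi [{}M b M0 {}B pM|{}M h M0 {}B r theta pM fi].
  by apply: cstep_solve; apply: (perm_map (subst_constr (ren C pi))) pM.
have [pi' piK pi'K] := bpi.
have -> : ren_cs pi (residue h r ++ M0)
          = residue (subst_atom (ren C pi) h) (ren_rule pi r) ++ ren_cs pi M0.
  by rewrite -residue_ren /ren_cs map_cat.
have -> : ren_bs pi (subst_eqs (head r) theta ++ B)
          = subst_eqs (head (ren_rule pi r))
              (fun x => subst_term (ren C pi) (theta (pi' x))) ++ ren_bs pi B.
  by rewrite /= (subst_eqs_ren _ _ piK) /ren_bs map_cat.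
apply: (cstep_apply (h := subst_atom (ren C pi) h)).
  exact: (perm_map (subst_constr (ren C pi))) pM.
exact: (fires_ren piK pi'K fi).
Qed.

Lemma cinert_ren pi I S M B : bijective pi -> cinert I S M B ->
  cinert (map pi I) S (ren_cs pi M) (ren_bs pi B).
Proof.
move=> [pi' piK pi'K] [nb nf]; split.
  by move=> b; apply/mapP => -[[b'|//] b'M _]; move: b'M; rewrite (negbTE (nb b')).
move=> h r theta /mapP[[//|h'] h'M [->]] /(fires_ren pi'K piK).
rewrite -map_comp (eq_map piK) map_id /ren_cs /ren_bs -!map_comp.
have idK (T : Type) (f : T -> T) (s : seq T) : f =1 id -> map f s = s.
  by move=> fid; rewrite (eq_map fid) map_id.
rewrite !idK; last 2 first.
- by move=> b /=; rewrite subst_builtin_comp subst_builtin_id // => x _ /=; rewrite piK.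
- by move=> b /=; rewrite subst_constr_comp subst_constr_id // => x _ /=; rewrite piK.
rewrite subst_atom_comp subst_atom_id; last by move=> x _ /=; rewrite piK.
exact: nf.
Qed.

Lemma ctrace_ren pi I n M B S H : bijective pi -> ctrace I n M B S H ->
  ctrace (map pi I) n (ren_cs pi M) (ren_bs pi B) S H.
Proof.
move=> bpi; elim=> {n M B S H}.
- by move=> M B S nS; exact: ct_fail.
- by move=> M B S inert; apply: ct_done; exact: cinert_ren.
- move=> M B S H j n M1 B1 st sub _ IH; apply: ct_silent IH.
    exact: cstep_ren st.
  by rewrite proj_ren.
- move=> M B S H j n M1 B1 S1 st sub _ IH; apply: ct_own IH.
    exact: cstep_ren st.
  by rewrite proj_ren.
- by move=> M B S H n S1 _ IH; exact: ct_env.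
Qed.

Lemma perm_cvars M M' : perm_eq M M' -> cvars M =i cvars M'.
Proof. by move=> pM x; apply/idP/idP; apply: cvars_sub => c; rewrite (perm_mem pM). Qed.

Lemma fires_mem I S M M' B h r theta : cvars M =i cvars M' ->
  fires I S M B h r theta -> fires I S M' B h r theta.
Proof.
move=> eM [vr fr hE ent]; split=> //; rewrite (eq_has (a2 := [in I ++ cvars M ++ fv B])) //.
by move=> x /=; rewrite !mem_cat eM.
Qed.

Lemma cstep_perm I S M M' B n M1 B1 : perm_eq M' M ->
  cstep I S M B n M1 B1 -> cstep I S M' B n M1 B1.
Proof.
move=> pM st.
case: st pM => [{}M b M0 {}B pM' pM|{}M h M0 {}B r theta pM' fi pM].
  by apply: cstep_solve; apply: perm_trans pM'.
apply: (cstep_apply (h := h)); first exact: perm_trans pM'.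
by apply: fires_mem fi; apply: perm_cvars; rewrite perm_sym.
Qed.

Lemma ctrace_perm I n M M' B S H : perm_eq M' M ->
  ctrace I n M B S H -> ctrace I n M' B S H.
Proof.
move=> pM tr; elim: tr M' pM => {n M B S H}.
- by move=> M B S nS M' _; exact: ct_fail.
- move=> M B S [nb nf] M' pM; apply: ct_done; split.
    by move=> b; rewrite (perm_mem pM).
  move=> h r theta; rewrite (perm_mem pM) => hM fi; apply: (nf h r theta hM).
  by apply: fires_mem fi; apply: perm_cvars.
- move=> M B S H j n M1 B1 st sub tr _ M' pM; apply: ct_silent tr => //.
  exact: cstep_perm st.
- move=> M B S H j n M1 B1 S1 st sub tr _ M' pM; apply: ct_own tr => //.
  exact: cstep_perm st.
- by move=> M B S H n S1 _ IH M' pM; apply: ct_env; exact: IH.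
Qed.

End Components.

(** * Composition *)

Section Joint.
Variables (Pr C : eqType) (P : seq (rule Pr C)).
Implicit Types (a h : atom Pr C) (r : rule Pr C) (I : seq nat).
Implicit Types (B D : seq (builtin C)) (M : seq (constr Pr C)).
Implicit Types (S : seq C -> Prop) (H : seq (bool * (seq C -> Prop))).
Implicit Types (K : config Pr C) (delta : seq (step Pr C)).

Definition content K : seq (constr Pr C) := goal K ++ [seq Chr hq.1 | hq <- store K].

Lemma vars_configE K : vars_config K =i cvars (content K) ++ fv (bstore K).
Proof.
move=> x; rewrite /vars_config /content cvars_cat -catA !mem_cat.
by rewrite {2}/cvars -map_comp.
Qed.

Definition is_apply (s : step Pr C) : bool := if s is Apply _ _ then true else false.
Definition napply delta : nat := count is_apply delta.

Definition final K : Prop :=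
  inconsistent (bstore K) \/ (goal K = [::] /\ ~ applicable P K).

Definition finishes K n : Prop :=
  exists delta K', [/\ run P K delta K', final K' & napply delta <= n].

Lemma run_cat K delta K' delta' K'' :
  run P K delta K' -> run P K' delta' K'' -> run P K (delta ++ delta') K''.
Proof.
elim=> // {delta K'} K0 s K1 delta K2 st _ IH /IH; exact: run_cons.
Qed.

Lemma finishes_run K delta K' n :
  run P K delta K' -> finishes K' n -> finishes K (napply delta + n).
Proof.
move=> rd [delta' [K'' [rd' fin le]]]; exists (delta ++ delta'), K''; split=> //.
  exact: run_cat rd rd'.
by rewrite /napply count_cat leq_add2l.
Qed.

Lemma finishes_le K n n' : n <= n' -> finishes K n -> finishes K n'.
Proof.
move=> le [delta [K' [rd fin le']]]; exists delta, K'; split=> //.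
exact: leq_trans le.
Qed.

Lemma run1 K s K' : trans P K s K' -> run P K [:: s] K'.
Proof. by move=> st; apply: run_cons st _; exact: run_nil. Qed.

Lemma mem_split (T : eqType) (x : T) s : x \in s -> exists s1 s2, s = s1 ++ x :: s2.
Proof. by case/splitPr=> s1 s2; exists s1, s2. Qed.

Lemma perm_cons_split (T : eqType) (x : T) s1 s2 s :
  perm_eq (s1 ++ x :: s2) (x :: s) -> perm_eq (s1 ++ s2) s.
Proof. by move=> p; rewrite -(perm_cons x) -(permPr p) -cat1s perm_catCA. Qed.

Lemma run_solve K b M0 : perm_eq (content K) (BI b :: M0) ->
  exists delta K', [/\ run P K delta K', napply delta = 0, perm_eq (content K') M0
                     & bstore K' = b :: bstore K].
Proof.
case: K => G St B n; rewrite /content /= => pM.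
have : BI b \in G.
  have : BI b \in G ++ [seq Chr hq.1 | hq <- St] by rewrite (perm_mem pM) mem_head.
  by rewrite mem_cat => /orP[//|/mapP[]].
case/mem_split=> G1 [G2 GE]; rewrite {}GE in pM *.
exists [:: Solve (size G1)], (Config (G1 ++ G2) St (b :: B) n); split=> //.
  by apply: run1; exact: trans_solve.
by rewrite /content /= -catA; apply: (@perm_cons_split _ (BI b)); rewrite -cat_cons catA.
Qed.

Lemma run_introduce K a : Chr a \in goal K ->
  exists delta K' q, [/\ run P K delta K', napply delta = 0,
    perm_eq (content K') (content K), bstore K' = bstore K &
    (a, q) \in store K' /\ size (goal K) = (size (goal K')).+1].
Proof.
case: K => G St B n; rewrite /content /= => /mem_split[G1 [G2 ->]].
exists [:: Introduce (size G1) n], (Config (G1 ++ G2) ((a, n) :: St) B n.+1), n; split=> //.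
- by apply: run1; exact: trans_introduce.
- by rewrite /= -!catA perm_cat2l /= -cat1s perm_catCA.
- by rewrite mem_head !size_cat /= addnS.
Qed.

Lemma run_introduce_all K : (forall b, BI b \notin goal K) ->
  exists delta K', [/\ run P K delta K', napply delta = 0,
    perm_eq (content K') (content K), bstore K' = bstore K & goal K' = [::]].
Proof.
have [n] := ubnP (size (goal K)); elim: n K => // n IH K szK nb.
case GE : (goal K) => [|[b|a] G].
- by exists [::], K; split=> //; exact: run_nil.
- by have := nb b; rewrite GE mem_head.
have [|delta [K1 [q [rd nd pK bK [_ szK1]]]]] := @run_introduce K a.
  by rewrite GE mem_head.
have [||delta' [K2 [rd' nd' pK' bK' gK']]] := IH K1.
- by move: szK; rewrite szK1.
- move=> b; apply/negP => bG.
  have : BI b \in content K1 by rewrite mem_cat bG.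
  rewrite (perm_mem pK) mem_cat (negbTE (nb b)) /=.
  by case/mapP.
exists (delta ++ delta'), K2; split=> //.
- exact: run_cat rd rd'.
- by rewrite /napply count_cat -!/(napply _) nd nd'.
- exact: perm_trans pK' pK.
- by rewrite bK'.
Qed.

Lemma renamed_apartE K r :
  renamed_apart P K r <-> variant P r /\ ~~ has [in vars_config K] (vars_rule r).
Proof.
split=> [[rho [r0 [brho r0P rE fr]]]|[[rho [r0 [brho r0P rE]]] fr]].
  by split=> //; exists rho, r0.
by exists rho, r0.
Qed.

Lemma run_apply K h M0 r theta : perm_eq (content K) (Chr h :: M0) ->
  renamed_apart P K r -> h = subst_atom theta (head r) ->
  entails (bstore K) (subst_eqs (head r) theta ++ guard r) ->
  exists delta K', [/\ run P K delta K', napply delta = 1,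
    perm_eq (content K') (residue h r ++ M0)
    & bstore K' = subst_eqs (head r) theta ++ bstore K].
Proof.
move=> pM ra hE ent.
have [d0 [K0 [q [rd0 nd0 pK0 bK0 hq]]]] : exists d0 K0 q,
    [/\ run P K d0 K0, napply d0 = 0, perm_eq (content K0) (content K),
        bstore K0 = bstore K & (h, q) \in store K0].
  have : Chr h \in content K by rewrite (perm_mem pM) mem_head.
  rewrite mem_cat => /orP[/run_introduce[d0 [K0 [q [rd nd pK bK [hq _]]]]]|].
    by exists d0, K0, q.
  case/mapP=> -[h' q] hq [->]; exists [::], K, q; split=> //; exact: run_nil.
have ra0 : renamed_apart P K0 r.
  apply/renamed_apartE; case/renamed_apartE: ra => vr fr; split=> //.
  rewrite (eq_has (a2 := [in vars_config K])) // => x /=.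
  by rewrite !vars_configE !mem_cat (perm_cvars pK0) bK0.
move: pM; rewrite -(permPl pK0) => {pK0} pM; rewrite -bK0 in ent *.
have [S1 [S2 SE]] := mem_split hq.
case: K0 SE rd0 ra0 ent pM {hq bK0} => G St B n /= -> rd0 ra0 ent pM.
exists (d0 ++ [:: Apply q r]),
  (Config (body r ++ G) (if is_simp r then S1 ++ S2 else S1 ++ (h, q) :: S2)
     (subst_eqs (head r) theta ++ B) n); split=> //.
- by apply: run_cat rd0 _; apply: run1; exact: trans_apply.
- by rewrite /napply count_cat -!/(napply _) nd0.
move: pM; rewrite /content /= map_cat /= catA => /perm_cons_split pM.
rewrite /residue -!catA perm_cat2l; case: (is_simp r); rewrite /= map_cat ?catA //=.
by rewrite -cat1s perm_catCA /= perm_cons.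
Qed.

(** A solution of [B1] with interface values in [S] is completed by a solution of [B2] having the
    same interface values; the two agree on shared variables, all of which lie in [I]. *)
Lemma entails_centails I B B1 B2 S D :
  B =i B1 ++ B2 -> {subset I <= fv B} ->
  (forall x, x \in fv B1 -> x \in fv B2 -> x \in I) ->
  (forall s, S s -> proj I B2 s) -> entails B D -> centails I B1 S D.
Proof.
move=> BE IB sep SB2 ent v vB1 /SB2[vo voB2 /eq_in_map vvo].
pose v1 x := if x \in fv B1 then v x else vo x.
have v1I : {in I ++ fv B1, v1 =1 v}.
  move=> x; rewrite mem_cat /v1 => /orP[xI|-> //].
  by case: ifP => // _; rewrite vvo.
have v1B : holds v1 B.
  apply: (holds_sub (B := B1 ++ B2)); first by move=> b; rewrite BE.
  rewrite /holds all_cat; apply/andP; split; first apply: etrans (holds_eq _) vB1.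
    by move=> x xB; rewrite v1I // mem_cat xB orbT.
  rewrite -/(holds v1 B2) (holds_eq (v' := vo)) // => x xB2; rewrite /v1.
  by case: ifP => // xB1; apply: vvo; exact: sep.
have [v' v'v1 v'D] := ent v1 v1B; exists v' => // x xI.
rewrite -v1I // v'v1 //; move: xI; rewrite mem_cat => /orP[/IB //|].
by apply: fv_sub => b bB; rewrite BE mem_cat bB.
Qed.

(** The variables of [D] known to [B2] are interface variables, which the component's witness
    already keeps fixed; outside [D] the given valuation can be restored. *)
Lemma centails_entails I B B1 B2 S D :
  B =i B1 ++ B2 -> (forall x, x \in fv D -> x \in fv B2 -> x \in I) ->
  (forall s, proj I B s -> S s) -> centails I B1 S D -> entails B D.
Proof.
move=> BE sep BS ent v vB.
have vB1 : holds v B1 by apply: holds_sub vB => b bB; rewrite BE mem_cat bB.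
have [|v' v'v v'D] := ent v vB1; first by apply: BS; exists v.
exists (fun x => if x \in fv B then v x else v' x); first by move=> x /= ->.
rewrite (holds_eq (v' := v')) // => x xD; case: ifP => // xB; symmetry; apply: v'v.
have : x \in fv (B1 ++ B2) by apply: fv_sub xB => b; rewrite BE.
by rewrite fv_cat !mem_cat => /orP[->|/sep -> //]; rewrite ?orbT.
Qed.

Lemma proj_sub I B B' : {subset B' <= B} -> forall s, proj I B s -> proj I B' s.
Proof. by move=> sB s [v vB ->]; exists v => //; exact: holds_sub vB. Qed.

Lemma proj_cat I B B1 B2 : B =i B1 ++ B2 ->
  (forall x, x \in fv B1 -> x \in fv B2 -> x \in I) ->
  forall s, proj I B s <-> proj I B1 s /\ proj I B2 s.
Proof.
move=> BE sep s; split=> [pB|[[v vB1 ->] [vo voB2 /eq_in_map vvo]]].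
  by split; apply: proj_sub pB => b bB; rewrite BE mem_cat bB ?orbT.
pose v1 x := if x \in fv B1 then v x else vo x.
exists v1; last first.
  by apply/eq_in_map => x xI; rewrite /v1; case: ifP => // _; exact: vvo.
apply: (holds_sub (B := B1 ++ B2)); first by move=> b; rewrite BE.
rewrite /holds all_cat; apply/andP; split; first apply: etrans (holds_eq _) vB1.
  by move=> x xB; rewrite /v1 xB.
rewrite -/(holds v1 B2) (holds_eq (v' := vo)) // => x xB2; rewrite /v1.
by case: ifP => // xB1; apply: vvo; exact: sep.
Qed.

(** The inclusion of [I] in the variables of the store forces the global existential reading of
    guards to keep the interface fixed, as [centails] does. *)
Definition joint I S M1 B1 M2 B2 K : Prop :=
  [/\ perm_eq (content K) (M1 ++ M2), bstore K =i B1 ++ B2, {subset I <= fv (bstore K)},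
      forall x, x \in cvars M1 ++ fv B1 -> x \in cvars M2 ++ fv B2 -> x \in I
    & forall s, S s <-> proj I B1 s /\ proj I B2 s].

Lemma joint_sym I S M1 B1 M2 B2 K : joint I S M1 B1 M2 B2 K -> joint I S M2 B2 M1 B1 K.
Proof.
case=> pM BE IB sep SE; split=> //.
- by rewrite perm_sym perm_catC perm_sym.
- by move=> b; rewrite BE !mem_cat orbC.
- by move=> x x2 x1; exact: sep.
- by move=> s; rewrite SE; split=> -[].
Qed.

Lemma joint_sep_fv I S M1 B1 M2 B2 K : joint I S M1 B1 M2 B2 K ->
  forall x, x \in fv B1 -> x \in fv B2 -> x \in I.
Proof. by case=> _ _ _ sep _ x x1 x2; apply: sep; rewrite mem_cat ?x1 ?x2 orbT. Qed.

Lemma joint_vars I S M1 B1 M2 B2 K : joint I S M1 B1 M2 B2 K ->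
  {subset I ++ cvars M1 ++ fv B1 <= vars_config K}.
Proof.
case=> pM BE IB _ _ x; rewrite vars_configE !mem_cat => /or3P[/IB -> |xM|xB].
- by rewrite orbT.
- apply/orP; left; apply: cvars_sub xM => c cM.
  by rewrite (perm_mem pM) mem_cat cM.
- apply/orP; right; apply: fv_sub xB => c cM.
  by rewrite BE mem_cat cM.
Qed.

Lemma joint_fires I S M1 B1 M2 B2 K h r theta : joint I S M1 B1 M2 B2 K ->
  renamed_apart P K r -> h = subst_atom theta (head r) ->
  entails (bstore K) (subst_eqs (head r) theta ++ guard r) ->
  fires P I S M1 B1 h r theta.
Proof.
move=> j /renamed_apartE[vr fr] hE ent; split=> //.
  apply: contra fr => /hasP[x xr xin]; apply/hasP; exists x => //.
  exact: joint_vars j _ xin.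
have [_ BE IB _ SE] := j.
apply: (entails_centails BE IB (joint_sep_fv j) _ ent).
by move=> s /SE[].
Qed.

Lemma fires_fresh I S M B h r theta (X : seq nat) : Chr h \in M ->
  fires P I S M B h r theta -> exists pi theta',
  [/\ bijective pi, {in I ++ cvars M ++ fv B, pi =1 id},
      fires P I S M B h (ren_rule pi r) theta',
      subst_eqs (head (ren_rule pi r)) theta' = ren_bs pi (subst_eqs (head r) theta)
    & ~~ has [in X] (vars_rule (ren_rule pi r))].
Proof.
move=> hM fi; have [_ fr _ _] := fi.
(* [vars_rule r] belongs to the set to be avoided because [fresh_bij] moves only members of that
   set. *)
have [pi [bpi idpi frpi]] := fresh_bij (I ++ cvars M ++ fv B) (X ++ vars_rule r).
have [pi' piK pi'K] := bpi.
exists pi, (fun x => subst_term (ren C pi) (theta (pi' x))); split=> //.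
- have := fires_ren piK pi'K fi.
  rewrite map_id_in; last by move=> x xI; apply: idpi; rewrite mem_cat xI.
  rewrite ren_cs_id; last by move=> x xI; apply: idpi; rewrite !mem_cat xI orbT.
  rewrite ren_bs_id; last by move=> x xI; apply: idpi; rewrite !mem_cat xI !orbT.
  rewrite subst_atom_id // => x xh; apply: idpi; rewrite !mem_cat.
  by apply/or3P/Or32; apply/cvarsP; exists (Chr h).
- exact: subst_eqs_ren.
rewrite vars_rule_ren has_map; apply/hasPn => x xr /=.
have /frpi : x \in X ++ vars_rule r by rewrite mem_cat xr orbT.
rewrite [_ \in X ++ _]mem_cat => /(_ (hasPn fr _ xr)); apply: contra => ->//.
Qed.

Lemma joint_entails I S M1 B1 M2 B2 K h r theta : joint I S M1 B1 M2 B2 K ->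
  Chr h \in M1 -> fires P I S M1 B1 h r theta -> ~~ has [in vars_config K] (vars_rule r) ->
  entails (bstore K) (subst_eqs (head r) theta ++ guard r).
Proof.
move=> j hM [_ _ hE ent] fr; have [pM BE IB sep SE] := j.
apply: (centails_entails BE _ _ ent); last first.
  by move=> s /(proj_cat BE (joint_sep_fv j)) /SE.
move=> x; rewrite fv_cat mem_cat fv_subst_eqs mem_cat -hE -orbA => xD xB2.
have xK : x \in vars_config K.
  rewrite vars_configE mem_cat; apply/orP; right; apply: fv_sub xB2 => c cB.
  by rewrite BE mem_cat cB orbT.
have : x \notin vars_rule r by apply: contra fr => xr; apply/hasP; exists x.
rewrite /vars_rule !mem_cat !negb_or -/(fv (guard r)) => /and3P[/negbTE n1 /negbTE n2 _].
move: xD; rewrite n1 n2 orbF /= => xh; apply: sep; rewrite mem_cat ?xB2 ?orbT //.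
by apply/orP; left; apply/cvarsP; exists (Chr h).
Qed.

Lemma joint_next I S S1 M1 B1 M1' B1' M2 B2 K K' : joint I S M1 B1 M2 B2 K ->
  perm_eq (content K') (M1' ++ M2) -> bstore K' =i B1' ++ B2 -> {subset B1 <= B1'} ->
  (forall x, x \in cvars M1' ++ fv B1' ->
     x \in cvars M1 ++ fv B1 \/ x \notin vars_config K) ->
  (forall s, S1 s <-> S s /\ proj I B1' s) -> joint I S1 M1' B1' M2 B2 K'.
Proof.
move=> j pM' BE' sB nv S1E; have [pM BE IB sep SE] := j; split=> //.
- move=> x /IB; apply: fv_sub => c; rewrite BE BE' !mem_cat => /orP[/sB ->//|->].
  exact: orbT.
- move=> x /nv[x1 x2|xK x2]; first exact: sep.
  by move: xK; rewrite (joint_vars (joint_sym j)) // mem_cat x2 orbT.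
- move=> s; rewrite S1E SE; split=> [[[p1 p2] p1']|[p1' p2]] //.
  by split=> //; split=> //; exact: proj_sub p1'.
Qed.

Lemma apply_vars M h M0 B r theta x : perm_eq M (Chr h :: M0) ->
  h = subst_atom theta (head r) ->
  x \in cvars (residue h r ++ M0) ++ fv (subst_eqs (head r) theta ++ B) ->
  x \in cvars M ++ fv B \/ x \in vars_rule r.
Proof.
move=> pM hE; rewrite cvars_cat fv_cat !mem_cat fv_subst_eqs mem_cat -hE.
rewrite (perm_cvars pM) cvars_cons mem_cat [vars_constr _]/= /residue cvars_cat mem_cat.
have -> : x \in cvars (if is_simp r then [::] else [:: Chr h])
          = ~~ is_simp r && (x \in vars_atom h).
  by case: (is_simp r); rewrite // cvars_cons cats0.
case: (x \in vars_atom h); first by left.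
rewrite andbF orbF; case: (x \in cvars M0); first by left; rewrite orbT.
case: (x \in fv B); first by left; rewrite !orbT.
by rewrite !orbF => xr; right; case/orP: xr => ->; rewrite ?orbT.
Qed.

(** The variant used by the component may clash with the other one. A permutation fixing the
    component's present variables makes it fresh, at the price of reaching a renamed state. *)
Lemma advance I S S1 M1 B1 M2 B2 K n M1' B1' : joint I S M1 B1 M2 B2 K ->
  cstep P I S M1 B1 n M1' B1' -> (forall s, S1 s <-> S s /\ proj I B1' s) ->
  exists pi delta K', [/\ bijective pi, map pi I = I, run P K delta K', napply delta = n
    & joint I S1 (ren_cs pi M1') (ren_bs pi B1') M2 B2 K'].
Proof.
move=> j st; case: st j => [{}M1 b M0 {}B1 pM1|{}M1 h M0 {}B1 r theta pM1 fi] j S1E.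
  have [pM BE _ _ _] := j.
  have [|delta [K' [rd nd pK' bK']]] := @run_solve K b (M0 ++ M2).
    by apply: perm_trans pM _; rewrite -cat_cons perm_cat2r.
  exists id, delta, K'; split=> //; first by exists id.
    by rewrite map_id.
  rewrite ren_cs_id // ren_bs_id //; apply: joint_next j _ _ _ _ S1E => //.
  - by move=> c; rewrite bK' !inE BE mem_cat orbA.
  - by move=> c cB; rewrite inE cB orbT.
  - move=> x xin; left; move: xin; rewrite !mem_cat (perm_cvars pM1) /cvars /= /fv /=.
    by rewrite !mem_cat; do 3 case: (_ \in _).
have [pM BE _ _ _] := j.
have hM1 : Chr h \in M1 by rewrite (perm_mem pM1) mem_head.
have [pi [theta' [bpi idpi fi' eqs fr]]] := fires_fresh (vars_config K) hM1 fi.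
have vh x : x \in vars_atom h -> x \in cvars M1 by move=> xh; apply/cvarsP; exists (Chr h).
set r' := ren_rule pi r in eqs fr fi'.
have ent := joint_entails j hM1 fi' fr; have [vr' _ hE _] := fi'.
have [||delta [K' [rd nd pK' bK']]] := @run_apply K h (M0 ++ M2) r' theta' _ _ hE ent.
- by apply: perm_trans pM _; rewrite -cat_cons perm_cat2r.
- by apply/renamed_apartE.
have idM0 : ren_cs pi M0 = M0.
  apply: ren_cs_id => x xM0; apply: idpi; rewrite !mem_cat (perm_cvars pM1).
  by rewrite {1}/cvars /= mem_cat -/(cvars M0) xM0 !orbT.
have idB1 : ren_bs pi B1 = B1.
  by apply: ren_bs_id => x xB; apply: idpi; rewrite !mem_cat xB !orbT.
have idI : map pi I = I.
  by apply: map_id_in => x xI; apply: idpi; rewrite mem_cat xI.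
have hpi : subst_atom (ren C pi) h = h.
  by apply: subst_atom_id => x /vh xM; apply: idpi; rewrite !mem_cat xM orbT.
have ME : ren_cs pi (residue h r ++ M0) = residue h r' ++ M0.
  by rewrite /ren_cs map_cat -!/(ren_cs _ _) residue_ren idM0 hpi.
have BE' : ren_bs pi (subst_eqs (head r) theta ++ B1) = subst_eqs (head r') theta' ++ B1.
  by rewrite /ren_bs map_cat -!/(ren_bs _ _) idB1 eqs.
exists pi, delta, K'; split=> //; rewrite ME BE'; apply: joint_next j _ _ _ _ _.
- by rewrite -catA.
- by move=> c; rewrite bK' -catA ![RHS]mem_cat mem_cat BE mem_cat.
- by move=> c cB; rewrite mem_cat cB orbT.
- move=> x /(apply_vars pM1 hE)[|xr]; [by left|right].
  by apply: contra fr => xK; apply/hasP; exists x.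
- by move=> s; rewrite S1E -BE' -[X in proj X (ren_bs _ _)]idI proj_ren.
Qed.

Lemma joint_stateE I S M1 B1 M2 B2 K :
  joint I S M1 B1 M2 B2 K -> S = proj I (bstore K).
Proof.
move=> j; have [_ BE _ _ SE] := j; apply/funext => s; apply/propext.
by rewrite SE (proj_cat BE (joint_sep_fv j)).
Qed.

Lemma joint_perm I S M1 B1 M2 B2 M1' M2' K : perm_eq M1 M1' -> perm_eq M2 M2' ->
  joint I S M1 B1 M2 B2 K -> joint I S M1' B1 M2' B2 K.
Proof.
move=> p1 p2 [pM BE IB sep SE]; split=> //.
  by apply: perm_trans pM _; exact: perm_cat.
by move=> x; rewrite !mem_cat -(perm_cvars p1) -(perm_cvars p2) -!mem_cat; exact: sep.
Qed.

Lemma applicable_mem K h q r theta : (h, q) \in store K -> renamed_apart P K r ->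
  h = subst_atom theta (head r) ->
  entails (bstore K) (subst_eqs (head r) theta ++ guard r) -> applicable P K.
Proof.
case: K => G St B n /= /mem_split[S1 [S2 ->]] ra hE ent; exists q, r.
by eexists; exact: trans_apply ra hE ent.
Qed.

(** The first event of the trace is due: no silent step precedes it. *)
Definition ready I n M B S H : Prop :=
  match H with
  | [::] => ~ nonempty S \/ cinert P I S M B
  | (true, S1) :: H1 => exists j n1 M1 B1,
      [/\ n = j + n1, cstep P I S M B j M1 B1,
          forall s, S1 s <-> S s /\ proj I B1 s & ctrace P I n1 M1 B1 S1 H1]
  | (false, S1) :: H1 => ctrace P I n M B S1 H1
  end.

Lemma ren_cs_comp pi rho M : ren_cs pi (ren_cs rho M) = ren_cs (pi \o rho) M.
Proof. by rewrite /ren_cs -map_comp; apply: eq_map => c /=; rewrite subst_constr_comp. Qed.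

Lemma ren_bs_comp pi rho B : ren_bs pi (ren_bs rho B) = ren_bs (pi \o rho) B.
Proof. by rewrite /ren_bs -map_comp; apply: eq_map => c /=; rewrite subst_builtin_comp. Qed.

(** Silent steps leave the interface state alone, so one component can perform them at once without
    disturbing the trace of the other. The renaming [pi] accumulates those made by [advance]. *)
Lemma drain I n M B S H : ctrace P I n M B S H ->
  forall pi M2 B2 K, bijective pi -> map pi I = I ->
  joint I S (ren_cs pi M) (ren_bs pi B) M2 B2 K ->
  exists n' M' B' K' delta, [/\ run P K delta K', napply delta + n' <= n,
    joint I S M' B' M2 B2 K' & ready I n' M' B' S H].
Proof.
have here n0 M0 B0 S0 H0 M2 B2 K : joint I S0 M0 B0 M2 B2 K -> ready I n0 M0 B0 S0 H0 ->
    exists n' M' B' K' delta, [/\ run P K delta K', napply delta + n' <= n0,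
      joint I S0 M' B' M2 B2 K' & ready I n' M' B' S0 H0].
  by move=> j rdy; exists n0, M0, B0, K, [::]; split=> //; exact: run_nil.
elim=> {n M B S H}.
- by move=> M B S nS pi M2 B2 K bpi piI j; apply: here j _; left.
- move=> M B S nS pi M2 B2 K bpi piI j; apply: here j _; right.
  by rewrite -piI; exact: cinert_ren.
- move=> M B S H jn n M1 B1 st sub _ IH pi M2 B2 K bpi piI j.
  have st' := cstep_ren bpi st; rewrite piI in st'.
  have [|pi' [delta [K' [bpi' piI' rd nd j']]]] := advance (S1 := S) j st'.
    by move=> s; rewrite -[in proj I]piI proj_ren //; split=> [Ss|[]//]; split=> //; exact: sub.
  rewrite ren_cs_comp ren_bs_comp in j'.
  have [||n' [M' [B' [K'' [delta' [rd' nd' j'' rdy]]]]]] := IH _ _ _ _ _ _ j'.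
  + exact: bij_comp.
  + by rewrite map_comp piI.
  exists n', M', B', K'', (delta ++ delta'); split=> //.
    exact: run_cat rd rd'.
  by rewrite /napply count_cat -!/(napply _) nd -addnA leq_add2l.
- move=> M B S H jn n M1 B1 S1 st sub tr _ pi M2 B2 K bpi piI j.
  apply: here j _; exists jn, n, (ren_cs pi M1), (ren_bs pi B1).
  by split=> //; rewrite -piI ?proj_ren //; [exact: cstep_ren | exact: ctrace_ren].
- move=> M B S H n S1 tr _ pi M2 B2 K bpi piI j.
  by apply: here j _; rewrite /= -piI; exact: ctrace_ren.
Qed.

Lemma trans_applyP K q r K' : trans P K (Apply q r) K' -> exists h theta,
  [/\ (h, q) \in store K, renamed_apart P K r, h = subst_atom theta (head r)
    & entails (bstore K) (subst_eqs (head r) theta ++ guard r)].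
Proof.
move=> st; inversion st as [| |G S1 h q' S2 B n r' theta ra hE ent].
by exists h, theta; rewrite /= mem_cat mem_head orbT.
Qed.

Lemma joint_inert I S M1 B1 M2 B2 K r h q theta : joint I S M1 B1 M2 B2 K ->
  cinert P I S M1 B1 -> cinert P I S M2 B2 -> (h, q) \in store K ->
  renamed_apart P K r -> h = subst_atom theta (head r) ->
  entails (bstore K) (subst_eqs (head r) theta ++ guard r) -> False.
Proof.
move=> j [_ in1] [_ in2] hq ra hE ent; have [pM _ _ _ _] := j.
have : Chr h \in content K.
  by rewrite mem_cat; apply/orP; right; apply/mapP; exists (h, q).
rewrite (perm_mem pM) mem_cat => /orP[/in1|/in2].
  by move=> nf; exact: nf (joint_fires j ra hE ent).
by move=> nf; exact: nf (joint_fires (joint_sym j) ra hE ent).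
Qed.

Definition dual H := [seq (~~ x.1, x.2) | x <- H].

(** By induction on the history. Once both components have exhausted their silent steps, the next
    change is an own step of exactly one of them, while the other merely undergoes it; performing
    that step restores the invariant with a shorter history. *)
Lemma compose I S H : forall n1 M1 B1 n2 M2 B2 K,
  ctrace P I n1 M1 B1 S H -> ctrace P I n2 M2 B2 S (dual H) ->
  joint I S M1 B1 M2 B2 K -> finishes K (n1 + n2).
Proof.
elim: H S => [|[o S1] H IH] S n1 M1 B1 n2 M2 B2 K tr1 tr2 j0.
all: have idb : bijective (@id nat) by exists id.
all: have idI : map id I = I by rewrite map_id.
all: have renc M : ren_cs id M = M by exact: ren_cs_id.
all: have renb B : ren_bs id B = B by exact: ren_bs_id.
all: have [|n1' [M1' [B1' [K1 [d1 [rd1 nd1 j1 rdy1]]]]]] :=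
  drain tr1 (M2 := M2) (B2 := B2) (K := K) idb idI.
all: rewrite ?renc ?renb //.
all: have [|n2' [M2' [B2' [K2 [d2 [rd2 nd2 j2 rdy2]]]]]] :=
  drain tr2 (M2 := M1') (B2 := B1') (K := K1) idb idI.
all: rewrite ?renc ?renb //; try exact: joint_sym.
all: have le : napply (d1 ++ d2) + (n1' + n2') <= n1 + n2 by
  rewrite /napply count_cat -!/(napply _); lia.
all: apply: finishes_le le _; apply: (finishes_run (run_cat rd1 rd2)).
all: have {}j2 := joint_sym j2.
  (* The history is over: either the whole store is inconsistent, or both components are inert and
     it remains to introduce the pending constraints. *)
  have emptyK : ~ nonempty S -> finishes K2 (n1' + n2').
    move=> nS; exists [::], K2; split=> //; first exact: run_nil.
    left=> v; apply/negP => vB; apply: nS; exists (map v I).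
    have [_ BE _ _ SE] := j2; apply/SE/(proj_cat BE (joint_sep_fv j2)).
    by exists v.
  case: rdy1 => [/emptyK //|in1]; case: rdy2 => [/emptyK //|in2].
  have [pM BE IB sep SE] := j2.
  have [|delta [K3 [rd3 nd3 pK3 bK3 gK3]]] := @run_introduce_all K2.
    move=> b; apply/negP => bG.
    have : BI b \in content K2 by rewrite mem_cat bG.
    rewrite (perm_mem pM) mem_cat.
    by case: in1 => /(_ b) /negbTE -> _; case: in2 => /(_ b) /negbTE ->.
  exists delta, K3; split=> //; last by rewrite nd3.
  right; split=> // -[q [r [K4 st]]].
  have j3 : joint I S M1' B1' M2' B2' K3.
    by split=> //; rewrite ?bK3 //; exact: perm_trans pK3 pM.
  have [h [theta [hq ra hE ent]]] := trans_applyP st.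
  exact: joint_inert j3 in1 in2 hq ra hE ent.
case: o tr1 tr2 rdy1 rdy2 => /= _ _.
  move=> [j [n [M' [B' [-> st SE tr1]]]]] tr2.
  have [pi [d [K3 [bpi piI rd nd j3]]]] := advance j2 st SE.
  rewrite -addnA -nd; apply: finishes_run rd _; apply: IH j3 => //.
  by rewrite -piI; exact: ctrace_ren.
move=> tr1 [j [n [M' [B' [-> st SE tr2]]]]].
have [pi [d [K3 [bpi piI rd nd j3]]]] := advance (joint_sym j2) st SE.
rewrite addnCA -nd; apply: finishes_run rd _; apply: IH (joint_sym j3) => //.
by rewrite -piI; exact: ctrace_ren.
Qed.

End Joint.

(** * Decomposition *)

Section Select.
Variable T : eqType.

Fixpoint sel (f : nat -> bool) (s : seq T) : seq T :=
  if s is x :: s' then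
    (if f 0 then [:: x] else [::]) ++ sel (fun p => f p.+1) s'
  else [::].

Lemma eq_sel f g s : (forall p, p < size s -> f p = g p) -> sel f s = sel g s.
Proof.
elim: s f g => //= x s IH f g fg; rewrite fg //; congr (_ ++ _).
by apply: IH => p ps; apply: fg.
Qed.

Lemma sel_cat f s1 s2 : sel f (s1 ++ s2) = sel f s1 ++ sel (fun p => f (size s1 + p)) s2.
Proof. by elim: s1 f => //= x s IH f; rewrite IH catA. Qed.

Lemma sel_const f b s : (forall p, p < size s -> f p = b) ->
  sel f s = if b then s else [::].
Proof.
move=> fb; rewrite (eq_sel (g := fun=> b)) //.
by elim: s {fb} => //= [|x s ->]; case: b.
Qed.

Lemma sel_bump f s1 x s2 :
  perm_eq (sel f (s1 ++ x :: s2))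
    ((if f (size s1) then [:: x] else [::])
       ++ sel (fun p => f (bump (size s1) p)) (s1 ++ s2)).
Proof.
rewrite !sel_cat /= addn0 perm_catCA.
rewrite (@eq_sel (fun p => f (bump _ p)) f s1); last first.
  by move=> p ps; rewrite /bump leqNgt ps.
rewrite perm_cat2l perm_cat2l (@eq_sel _ (fun p => f (bump (size s1) (size s1 + p)))) //.
by move=> p _; rewrite /bump leq_addr addnS.
Qed.

Lemma perm_sel f s : perm_eq s (sel f s ++ sel (fun p => ~~ f p) s).
Proof.
elim: s f => //= x s IH f; case: (f 0) => /=; first by rewrite perm_cons.
by rewrite perm_sym perm_catC /= perm_cons perm_catC perm_sym.
Qed.

End Select.

Section Decompose.
Variables (Pr C : eqType) (P : seq (rule Pr C)) (c0 : C) (U : seq C) (w : nat).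
Implicit Types (a h : atom Pr C) (r : rule Pr C) (I : seq nat).
Implicit Types (B D : seq (builtin C)) (M : seq (constr Pr C)).
Implicit Types (S : seq C -> Prop) (H : seq (bool * (seq C -> Prop))).
Implicit Types (K : config Pr C) (delta : seq (step Pr C)).
Implicit Types (s : step Pr C) (cg cs : nat -> bool).

Definition wf_ids K : bool :=
  uniq (map snd (store K)) && all (fun q => q < next K) (map snd (store K)).

Definition ok_constr (c : constr Pr C) : bool :=
  all [in U] (csts_constr c) && (if c is Chr a then arity a <= w else true).

Definition ok_config K : bool :=
  all ok_constr (content K) && all [in U] (bcsts (bstore K)).

Lemma ok_configE G St B n : ok_config (Config G St B n)
  = all ok_constr (G ++ [seq Chr hq.1 | hq <- St]) && all [in U] (bcsts B).
Proof. by []. Qed.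

Lemma wf_idsE G St B n : wf_ids (Config G St B n)
  = uniq (map snd St) && all (fun q => q < n) (map snd St).
Proof. by []. Qed.

Hypothesis okP : forall r c, r \in P -> c \in body r -> ok_constr c.

Lemma csts_constr_ren pi (c : constr Pr C) :
  csts_constr (subst_constr (ren C pi) c) = csts_constr c.
Proof.
have ht (t : term C) : csts_term (subst_term (ren C pi) t) = csts_term t by case: t.
case: c => [[||t t']|[p ts]] //=; first by rewrite !ht.
by rewrite /csts_atom /= -map_comp; congr flatten; apply: eq_map => t /=; rewrite ht.
Qed.

Lemma ok_variant r c : variant P r -> c \in body r -> ok_constr c.
Proof.
move=> [rho [r0 [_ r0P ->]]] /= /mapP[c' c'r ->].
have := okP r0P c'r; rewrite /ok_constr csts_constr_ren.
by case: c' {c'r} => //= a; rewrite /arity size_map.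
Qed.

Lemma ok_subst_eqs r h theta : h = subst_atom theta (head r) ->
  ok_constr (Chr h) -> all [in U] (bcsts (subst_eqs (head r) theta)).
Proof.
move=> hE /andP[/allP hU _]; apply/allP => c /flatten_mapP[b /mapP[x]].
rewrite mem_undup => /flatten_mapP[[y|//] yh]; rewrite inE => /eqP-> -> /= cx.
apply: hU; rewrite /= hE; apply/flatten_mapP; exists (theta y) => //.
by apply/mapP; exists (Var y).
Qed.

Lemma trans_wf K s K' : trans P K s K' -> wf_ids K -> wf_ids K'.
Proof.
case=> [G1 b G2 St B n|G1 a G2 St B n|G S1 h q S2 B n r theta _ _ _] //.
  rewrite !wf_idsE => /andP[un lt]; rewrite /= un ltnSn !andbT /=; apply/andP; split.
    by apply/negP => /(allP lt); rewrite ltnn.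
  by apply: sub_all lt => x; exact: ltnW.
rewrite !wf_idsE => /andP[]; case: (is_simp r) => [|-> ->] //.
rewrite !map_cat !all_cat /= -cat1s uniq_catCA cons_uniq.
by move=> /andP[_ ->] /and3P[-> _ ->].
Qed.

Lemma trans_ok K s K' : trans P K s K' -> ok_config K -> ok_config K'.
Proof.
case=> [G1 b G2 St B n|G1 a G2 St B n|G S1 h q S2 B n r theta ra hE _];
  rewrite !ok_configE.
- rewrite bcsts_cons !all_cat => /andP[/andP[/= /and3P[-> okb ->] ->] ->].
  by case/andP: okb => ->.
- rewrite !all_cat => /andP[/andP[/= /and3P[-> oka ->] ->] ->].
  by rewrite oka.
move=> /andP[okK BU].
have okh : ok_constr (Chr h).
  by apply: (allP okK); rewrite mem_cat map_cat mem_cat mem_head !orbT.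
have okr : all ok_constr (body r).
  by case/renamed_apartE: ra => vr _; apply/allP => c; exact: ok_variant.
rewrite bcsts_cat !all_cat (ok_subst_eqs hE okh) BU okr !andbT /=.
move: okK; rewrite all_cat => /andP[-> /=]; case: (is_simp r) => //.
by rewrite !map_cat !all_cat /= => /and3P[-> _ ->].
Qed.

(* Colourings [cg] of the goal positions and [cs] of the identifiers, updated so
   that every constraint inherits the colour of the one which generated it. *)
Definition next_g s cg cs : nat -> bool :=
  match s with
  | Solve j | Introduce j _ => fun p => cg (bump j p)
  | Apply q r => fun p => if p < size (body r) then cs q else cg (p - size (body r))
  end.

Definition next_s s cg cs : nat -> bool :=
  if s is Introduce j n then fun q => if q == n then cg j else cs q else cs.

Definition own_apply (o : bool) s cs : nat :=
  if s is Apply q _ then cs q == o else false.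

Fixpoint nown (o : bool) cg cs delta : nat :=
  if delta is s :: delta' then
    own_apply o s cs + nown o (next_g s cg cs) (next_s s cg cs) delta'
  else 0.

Lemma nown_total cg cs delta :
  nown true cg cs delta + nown false cg cs delta = napply delta.
Proof.
elim: delta cg cs => //= s delta IH cg cs.
rewrite addnACA IH -/(napply delta); congr (_ + _).
by case: s => //= q r; case: (cs q).
Qed.

Definition part (o : bool) cg cs K : seq (constr Pr C) :=
  sel (fun p => cg p == o) (goal K)
    ++ [seq Chr hq.1 | hq <- store K & cs hq.2 == o].

Lemma perm_part o cg cs K : perm_eq (content K) (part o cg cs K ++ part (~~ o) cg cs K).
Proof.
rewrite /content /part; have := perm_sel (fun p => cg p == o) (goal K).
set g1 := sel _ _; set g2 := sel _ _ => pg.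
have -> : sel (fun p => cg p == ~~ o) (goal K) = g2.
  by apply: eq_sel => p _; case: (cg p); case: o {g1 g2 pg}.
apply: perm_trans (perm_cat pg (perm_refl _)) _; rewrite -!catA perm_cat2l perm_sym perm_catCA.
rewrite perm_cat2l -map_cat; apply: perm_map.
have -> : [seq hq <- store K | cs hq.2 == ~~ o]
        = [seq hq <- store K | predC (fun hq => cs hq.2 == o) hq].
  by apply: eq_filter => hq /=; case: (cs _); case: o {g1 g2 pg}.
by apply: permEl; exact: perm_filterC.
Qed.

(** In the common history the boolean names the acting colour; this is the view of colour [o], in
    which [true] marks its own changes. *)
Definition hist (o : bool) H := [seq (x.1 == o, x.2) | x <- H].

(** A step that leaves the state unchanged is silent for its author and unnoticed by the other; a
    step that shrinks it enters the common history. *)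
Lemma hist_step I k S S1 o H1 j no nn Mo Bo Mo' Bo' Mn Bn :
  cstep P I S Mo Bo j Mo' Bo' -> (forall t, S1 t <-> S t /\ proj I Bo' t) ->
  eqclosed c0 U k S1 ->
  ctrace P I no Mo' Bo' S1 (hist o H1) -> ctrace P I nn Mn Bn S1 (hist (~~ o) H1) ->
  chain c0 U k S1 H1 ->
  exists H, [/\ ctrace P I (j + no) Mo Bo S (hist o H), ctrace P I nn Mn Bn S (hist (~~ o) H),
    chain c0 U k S H & last_state S H = last_state S1 H1].
Proof.
move=> st S1E cl tro trn ch; have [SE|nS] := pselect (S1 = S).
  exists H1; rewrite -SE; split=> //; apply: ct_silent tro; first by rewrite SE.
  by move=> s /S1E[].
exists ((o, S1) :: H1); rewrite /= eqxx; split=> //.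
- exact: ct_own st S1E tro.
- have -> : (o == ~~ o) = false by case: (o).
  exact: ct_env.
- by split=> // s /S1E[].
Qed.

Lemma decompose_step I K K' o cg cs cg' cs' Bp Bo' M' j :
  (forall o', joint I (proj I (bstore K)) (part o' cg cs K) (Bp o')
                (part (~~ o') cg cs K) (Bp (~~ o')) K) ->
  cstep P I (proj I (bstore K)) (part o cg cs K) (Bp o) j M' Bo' ->
  perm_eq (part o cg' cs' K') M' ->
  perm_eq (part (~~ o) cg cs K) (part (~~ o) cg' cs' K') ->
  {subset Bp o <= Bo'} -> bstore K' =i Bo' ++ Bp (~~ o) ->
  (forall x, x \in cvars M' ++ fv Bo' ->
     x \in cvars (part o cg cs K) ++ fv (Bp o) \/ x \notin vars_config K) ->
  let Bp' o' := if o' == o then Bo' else Bp o' in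
  (forall o', joint I (proj I (bstore K')) (part o' cg' cs' K') (Bp' o')
                (part (~~ o') cg' cs' K') (Bp' (~~ o')) K')
  /\ forall n H1,
    (forall o', ctrace P I (n o') (part o' cg' cs' K') (Bp' o') (proj I (bstore K'))
                  (hist o' H1)) ->
    eqclosed c0 U (size I) (proj I (bstore K')) ->
    chain c0 U (size I) (proj I (bstore K')) H1 ->
    exists H, [/\ forall o', ctrace P I ((if o' == o then j else 0) + n o')
                    (part o' cg cs K) (Bp o') (proj I (bstore K)) (hist o' H),
      chain c0 U (size I) (proj I (bstore K)) H
    & last_state (proj I (bstore K)) H = last_state (proj I (bstore K')) H1].
Proof.
move=> jt st po pn sB BE' nv Bp'.
have negE : (~~ o == o) = false by case: (o).
have cases o' : o' = o \/ o' = ~~ o by case: o'; case: (o); [left|right|right|left].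
pose S1 t := proj I (bstore K) t /\ proj I Bo' t.
have jo : joint I S1 (part o cg' cs' K') Bo' (part (~~ o) cg' cs' K') (Bp (~~ o)) K'.
  have j1 : joint I S1 M' Bo' (part (~~ o) cg cs K) (Bp (~~ o)) K'.
    apply: joint_next (jt o) _ BE' sB nv _ => //.
    apply: perm_trans (perm_part o cg' cs' K') _.
    by apply: perm_cat => //; rewrite perm_sym.
  by apply: joint_perm pn j1; rewrite perm_sym.
have S1E := joint_stateE jo; rewrite S1E in jo.
split.
  move=> o'; case: (cases o') => ->; rewrite /Bp' ?negbK eqxx negE //.
  exact: joint_sym.
move=> n H1 tr cl ch.
have tro : ctrace P I (n o) M' Bo' (proj I (bstore K')) (hist o H1).
  by have := tr o; rewrite /Bp' eqxx; apply: ctrace_perm; rewrite perm_sym.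
have trn := tr (~~ o); rewrite /Bp' negE in trn.
have [t|H [tro' trn' ch' lE]] := hist_step st _ cl tro (ctrace_perm pn trn) ch.
  by rewrite -S1E.
exists H; split=> // o'; case: (cases o') => ->; first by rewrite eqxx.
by rewrite negE.
Qed.

(** Built-ins carry no colour in a configuration, so [Bp] remembers which side contributed what.
    Each step belongs to one colour, and both colours see the same sequence of states because the
    state is always the projection of the whole store. *)
Lemma decompose I K delta K'' : run P K delta K'' -> final P K'' ->
  wf_ids K -> ok_config K ->
  forall cg cs (Bp : bool -> seq (builtin C)),
  (forall o, joint I (proj I (bstore K)) (part o cg cs K) (Bp o)
               (part (~~ o) cg cs K) (Bp (~~ o)) K) ->
  exists H,
  [/\ forall o, ctrace P I (nown o cg cs delta) (part o cg cs K) (Bp o)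
                  (proj I (bstore K)) (hist o H),
      chain c0 U (size I) (proj I (bstore K)) H
    & last_state (proj I (bstore K)) H = proj I (bstore K'')].
Proof.
elim=> {K delta K''}.
  move=> K fin wfK okK cg cs Bp jt; exists [::]; split=> // o /=.
  case: fin => [inc|[gK nap]].
    by apply: ct_fail => -[s [v vB _]]; have := inc v; rewrite vB.
  apply: ct_done; split; first by move=> b; rewrite /part gK /=; apply/mapP => -[].
  move=> h r theta hM fi; apply: nap.
  (* A rule that fires for one component, made fresh for the whole configuration, would be
     applicable there. *)
  have [pi [theta' [_ _ fi' _ fr]]] := fires_fresh (vars_config K) hM fi.
  have ent := joint_entails (jt o) hM fi' fr; have [vr' _ hE _] := fi'.
  move: hM; rewrite /part gK /= => /mapP[[h' q]]; rewrite mem_filter /= => /andP[_ hq] [hh].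
  rewrite -hh in hq; apply: applicable_mem hq _ hE ent.
  exact/renamed_apartE.
move=> K s K' delta K'' st _ IH fin wfK okK cg cs Bp jt.
have wfK' := trans_wf st wfK; have okK' := trans_ok st okK; have {}IH := IH fin wfK' okK'.
have cl := @proj_eqclosed C c0 U I (bstore K') (allP (proj2 (andP okK'))).
case: st wfK okK wfK' okK' IH jt cl => {K s K'}
  [G1 b G2 St B n|G1 a G2 St B n|G S1 h q S2 B n r theta ra hE ent] wfK okK wfK' okK' IH jt cl.
- set K := Config _ _ _ _ in jt okK wfK *; set K' := Config _ _ _ _ in IH okK' wfK' cl *.
  pose o := cg (size G1); pose cg' := next_g (Solve (size G1)) cg cs.
  have pp o' : perm_eq (part o' cg cs K)
      ((if o == o' then [:: BI b] else [::]) ++ part o' cg' cs K').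
    by rewrite /part catA perm_cat2r; exact: sel_bump.
  have po := pp o; have pn := pp (~~ o); rewrite eqxx /= in po.
  have neqN : (o == ~~ o) = false by case: (o).
  rewrite neqN /= in pn.
  have [|||||jt' next] := decompose_step (K' := K') (cg' := cg') (cs' := cs) (o := o)
    jt (cstep_solve _ _ _ _ po).
  + exact: perm_refl.
  + exact: pn.
  + by move=> c cB; rewrite inE cB orbT.
  + have [_ BE _ _ _] := jt o.
    by move=> c; rewrite !inE BE.
  + move=> x xin; left; move: xin; rewrite !mem_cat (perm_cvars po) cvars_cons /fv /=.
    by rewrite !mem_cat; do 3 case: (_ \in _).
  have [H1 [tr ch lE]] := IH _ _ _ jt'.
  have [H [tr' ch' lE']] := next _ _ tr cl ch.
  exists H; split=> //; last by rewrite lE' lE.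
  by move=> o'; have := tr' o'; rewrite if_same.
(* Introducing a constraint changes neither part; the new identifier takes over its colour and
   clashes with no stored one. *)
- set K := Config _ _ _ _ in jt okK wfK *; set K' := Config _ _ _ _ in IH okK' wfK' cl *.
  pose cg' := next_g (Introduce (size G1) n) cg cs.
  pose cs' := next_s (Introduce (size G1) n) cg cs.
  have pp o' : perm_eq (part o' cg cs K) (part o' cg' cs' K').
    have csn : cs' n = cg (size G1) by rewrite /cs' /= eqxx.
    rewrite /part /= csn.
    have -> : [seq hq <- St | cs' hq.2 == o'] = [seq hq <- St | cs hq.2 == o'].
      apply: eq_in_filter => -[h q] hq; rewrite /cs' /=; case: (eqVneq q n) => // qn.
      have : q < n by apply: (allP (proj2 (andP wfK))); apply/mapP; exists (h, q).
      by rewrite qn ltnn.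
    apply: perm_trans (perm_cat (sel_bump _ _ _ _) (perm_refl _)) _.
    by case: (cg _ == o') => //=; rewrite perm_sym -cat1s perm_catCA.
  have jt' o' : joint I (proj I (bstore K')) (part o' cg' cs' K') (Bp o')
                  (part (~~ o') cg' cs' K') (Bp (~~ o')) K'.
    have [pM BE IB sep SE] := jt o'; apply: joint_perm (pp o') (pp (~~ o')) _.
    split=> //; apply: perm_trans pM; rewrite /content /= -!catA perm_cat2l.
    by rewrite -[X in perm_eq _ X]cat1s perm_sym perm_catCA.
  have [H [tr ch lE]] := IH _ _ _ jt'; exists H; split=> // o'.
  exact: ctrace_perm (pp o') (tr o').
set K := Config _ _ _ _ in ra ent jt okK wfK *; set K' := Config _ _ _ _ in IH okK' wfK' cl *.
pose cg' := next_g (Apply q r) cg cs; pose cs' := next_s (Apply q r) cg cs; pose o := cs q.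
pose M0 := sel (fun p => cg p == o) G ++ [seq Chr hq.1 | hq <- S1 ++ S2 & cs hq.2 == o].
have selE o' : sel (fun p => cg' p == o') (body r ++ G)
    = (if o == o' then body r else [::]) ++ sel (fun p => cg p == o') G.
  rewrite sel_cat (@sel_const _ _ (o == o')); last by move=> p ps; rewrite /cg' /= ps.
  congr (_ ++ _); apply: eq_sel => p _.
  by rewrite /cg' /= ltnNge leq_addr /= addKn.
have po : perm_eq (part o cg cs K) (Chr h :: M0).
  rewrite /part /= !filter_cat /= eqxx !map_cat /= catA -cat1s perm_catCA /=.
  by rewrite perm_cons -catA /M0 filter_cat map_cat.
have fi := joint_fires (jt o) ra hE ent.
have po' : perm_eq (part o cg' cs' K') (residue h r ++ M0).
  by rewrite /part selE eqxx -!catA perm_cat2l; rewrite /K' /=; case: (is_simp r).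
have pn : perm_eq (part (~~ o) cg cs K) (part (~~ o) cg' cs' K').
  rewrite /part selE.
  have -> : (o == ~~ o) = false by case: (o).
  rewrite /cs' /=; case: (is_simp r) => //=; rewrite !filter_cat /=.
  by have -> : (cs q == ~~ o) = false by rewrite /o; case: (cs q).
have [|||jt' next] := decompose_step (K' := K') (cg' := cg') (cs' := cs') (o := o)
    jt (cstep_apply po fi) po' pn.
+ by move=> c cB; rewrite mem_cat cB orbT.
+ have [_ BE _ _ _] := jt o.
  by move=> c; rewrite -catA ![RHS]mem_cat mem_cat BE mem_cat.
+ move=> x /(apply_vars po hE)[|xr]; [by left|right].
  case/renamed_apartE: ra => _; apply: contra => xK; apply/hasP; exists x => //.
have [H1 [tr ch lE]] := IH _ _ _ jt'.
have [H [tr' ch' lE']] := next _ _ tr cl ch.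
exists H; split=> //; last by rewrite lE' lE.
move=> o'; have := tr' o'; rewrite -/o eq_sym /=.
by case: eqP.
Qed.
End Decompose.

(** * Replacing a component *)

Section Splice.
Variables (Pr C : eqType) (P : seq (rule Pr C)).
Implicit Types (a h : atom Pr C) (r : rule Pr C) (I : seq nat).
Implicit Types (B D : seq (builtin C)) (M : seq (constr Pr C)).
Implicit Types (H : seq (bool * (seq C -> Prop))) (K : config Pr C).

(** The matching equations only define fresh head variables, so any solution of [B] extends to
    them. *)
Lemma proj_subst_eqs I B r h theta : h = subst_atom theta (head r) ->
  ~~ has [in I ++ vars_atom h ++ fv B] (vars_atom (head r)) ->
  proj I (subst_eqs (head r) theta ++ B) = proj I B.
Proof.
move=> hE fr; apply/funext => s; apply/propext; split.
  by apply: proj_sub => b bB; rewrite mem_cat bB orbT.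
move=> [v vB ->].
have nr x : x \in I ++ vars_atom h ++ fv B -> x \in vars_atom (head r) = false.
  by move=> xin; apply: contraNF fr => xr; apply/hasP; exists x.
pose v' x := if x \in vars_atom (head r) then eval_term v (theta x) else v x.
exists v'; last first.
  by apply/eq_in_map => x xI; rewrite /v' nr // mem_cat xI.
rewrite /holds all_cat; apply/andP; split; last first.
  rewrite -/(holds v' B) (holds_eq (v' := v)) // => x xB.
  by rewrite /v' nr // !mem_cat xB !orbT.
apply/allP => b /mapP[x]; rewrite mem_undup => xr -> /=.
rewrite {1}/v' xr; apply/eqP/eval_eq => y yx; rewrite /v' nr // !mem_cat.
by apply/or3P/Or32; rewrite hE; apply/match_varsP; exists x.
Qed.

(** The descendants start with the matching equations alone, and the rest keeps the entire old
    store. Since the rule is fresh, the two sides share only variables of [h]. *)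
Lemma joint_fork K K' h Mo r theta : perm_eq (content K) (Chr h :: Mo) ->
  renamed_apart P K r -> h = subst_atom theta (head r) ->
  perm_eq (content K') (residue h r ++ Mo) ->
  bstore K' = subst_eqs (head r) theta ++ bstore K ->
  joint (vars_atom h) (proj (vars_atom h) (bstore K)) (residue h r)
    (subst_eqs (head r) theta) Mo (bstore K) K'.
Proof.
move=> pM /renamed_apartE[_ fr] hE pM' BE.
have hK x : x \in vars_atom h -> x \in vars_config K.
  move=> xh; rewrite vars_configE mem_cat; apply/orP; left; apply/cvarsP.
  by exists (Chr h); rewrite // (perm_mem pM) mem_head.
have nr x : x \in vars_config K -> x \notin vars_rule r.
  by move=> xK; apply: contra fr => xr; apply/hasP; exists x.
have BK x : x \in fv (bstore K) -> x \in vars_config K.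
  by rewrite vars_configE mem_cat => ->; rewrite orbT.
have sep x : x \in cvars (residue h r) ++ fv (subst_eqs (head r) theta) ->
    x \in cvars Mo ++ fv (bstore K) -> x \in vars_atom h.
  move=> x1 x2.
  have /nr xr : x \in vars_config K.
    rewrite vars_configE mem_cat (perm_cvars pM) cvars_cons mem_cat -orbA -mem_cat.
    by rewrite x2 orbT.
  have := @apply_vars _ _ [:: Chr h] h [::] [::] r theta x (perm_refl _) hE.
  rewrite !cats0 => av; case: (av x1) => [|xr']; first by rewrite cvars_cons cats0.
  by rewrite xr' in xr.
split=> //.
- by rewrite BE.
- by move=> x xh; rewrite BE fv_cat mem_cat fv_subst_eqs mem_cat -hE xh orbT.
move=> s; rewrite -(@proj_cat _ _ (subst_eqs (head r) theta ++ bstore K)) //; last first.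
  by move=> x x1 x2; apply: sep; rewrite mem_cat ?x1 ?x2 orbT.
rewrite (proj_subst_eqs hE) //; apply/hasPn => x xr; rewrite /= !mem_cat orbA orbb negb_or.
have xr' : x \in vars_rule r by rewrite mem_cat xr.
by apply/andP; split; apply/negP; [move=> /hK/nr|move=> /BK/nr]; rewrite xr'.
Qed.

(* Because guards are read existentially outside Fv(B), the first rule applied to a
   constraint depends also on which of its variables occur in the built-in store. *)
Lemma entails_transfer K K' h h' r' theta' pi pi' :
  cancel pi pi' -> cancel pi' pi ->
  map pi (vars_atom h') = vars_atom h ->
  ~~ has [in fv (bstore K)] (map pi (vars_rule r')) ->
  h' = subst_atom theta' (head r') ->
  proj (vars_atom h) (bstore K) = proj (vars_atom h') (bstore K') ->
  (forall i, i < size (vars_atom h') ->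
     (nth 0 (vars_atom h) i \in fv (bstore K)) = (nth 0 (vars_atom h') i \in fv (bstore K'))) ->
  entails (bstore K') (subst_eqs (head r') theta' ++ guard r') ->
  entails (bstore K) (ren_bs pi (subst_eqs (head r') theta' ++ guard r')).
Proof.
move=> piK pi'K hh fr hE SE VE ent v vB.
have [v1 v1B] : proj (vars_atom h') (bstore K') (map v (vars_atom h)).
  by rewrite -SE; exists v.
rewrite -hh -map_comp => /eq_in_map vv1.
have [v1' v1'E v1'D] := ent _ v1B.
exists (fun x => if x \in fv (bstore K) then v x else v1' (pi' x)); first by move=> x /= ->.
rewrite holds_ren (holds_eq (v' := v1')) // => z zD /=; rewrite piK.
case: ifP => // pzB.
have nzr : z \notin vars_rule r'.
  by apply: contra fr => zr; apply/hasP; exists (pi z) => //; exact: map_f.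
have zh : z \in vars_atom h'.
  move: zD; rewrite fv_cat mem_cat fv_subst_eqs mem_cat -hE => zD.
  move: nzr zD; rewrite /vars_rule !mem_cat -/(fv (guard r')) !negb_or.
  case/and3P=> /negbTE-> /negbTE-> _.
  by rewrite orbF.
rewrite v1'E; first exact: vv1.
have := VE (index z (vars_atom h')); rewrite index_mem zh => /(_ isT).
by rewrite -hh (nth_map 0) ?index_mem // nth_index // pzB.
Qed.

(** The rule used on [h'] in [K'] is applied to [h] in [K], which costs the leading 1; then the
    descendants from [K'] are composed with the remainder of [K]. *)
Lemma splice K K' h h' rho r' theta' Mo nin nout H :
  bijective rho -> h = subst_atom (ren C rho) h' ->
  perm_eq (content K) (Chr h :: Mo) -> Chr h' \in content K' ->
  renamed_apart P K' r' -> h' = subst_atom theta' (head r') ->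
  entails (bstore K') (subst_eqs (head r') theta' ++ guard r') ->
  proj (vars_atom h) (bstore K) = proj (vars_atom h') (bstore K') ->
  (forall i, i < size (vars_atom h') ->
     (nth 0 (vars_atom h) i \in fv (bstore K)) = (nth 0 (vars_atom h') i \in fv (bstore K'))) ->
  ctrace P (vars_atom h') nin (residue h' r') (subst_eqs (head r') theta')
    (proj (vars_atom h') (bstore K')) H ->
  ctrace P (vars_atom h) nout Mo (bstore K) (proj (vars_atom h) (bstore K)) (dual H) ->
  finishes P K (1 + (nin + nout)).
Proof.
move=> brho hh pM hM' /renamed_apartE[vr' fr'] hE ent SE VE trin trout.
have [pi0 [bpi0 idpi0 frpi0]] :=
  fresh_bij (vars_atom h) (vars_config K ++ map rho (vars_rule r')).
(* [rho] turns [h'] into [h]; [pi0] then fixes the variables of [h] and moves those of the rule away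
   from [K]. *)
pose pi := pi0 \o rho; have bpi : bijective pi by exact: bij_comp.
have [pi' piK pi'K] := bpi.
have hpi : subst_atom (ren C pi) h' = h by rewrite -subst_atom_comp -hh subst_atom_id.
have Ipi : map pi (vars_atom h') = vars_atom h by rewrite -vars_atom_ren hpi.
have frK : ~~ has [in vars_config K] (map pi (vars_rule r')).
  rewrite has_map; apply/hasPn => z zr /=.
  have /frpi0 : rho z \in vars_config K ++ map rho (vars_rule r').
    by rewrite mem_cat map_f ?orbT.
  have -> : rho z \notin vars_atom h.
    rewrite hh vars_atom_ren (mem_map (bij_inj brho)).
    apply: contra fr' => zh; apply/hasP; exists z => //=.
    rewrite vars_configE mem_cat; apply/orP; left.
    by apply/cvarsP; exists (Chr h').
  by move=> /(_ isT); rewrite mem_cat => /norP[].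
pose r := ren_rule pi r'; pose theta x := subst_term (ren C pi) (theta' (pi' x)).
have hr : h = subst_atom theta (head r) by rewrite (match_ren _ _ piK) -hE.
have eqs : subst_eqs (head r) theta = ren_bs pi (subst_eqs (head r') theta').
  exact: subst_eqs_ren.
have ra : renamed_apart P K r.
  by apply/renamed_apartE; split; [exact: variant_ren | rewrite vars_rule_ren].
have entK : entails (bstore K) (subst_eqs (head r) theta ++ guard r).
  rewrite eqs -/(ren_bs pi (guard r')) /ren_bs -map_cat.
  apply: (entails_transfer piK pi'K Ipi _ hE SE VE ent).
  apply: contra frK => /hasP[x xr xB]; apply/hasP; exists x => //=.
  by rewrite vars_configE mem_cat [X in _ || X]xB orbT.
have [delta [K2 [rd nd pK2 bK2]]] := run_apply pM ra hr entK.
have j := joint_fork pM ra hr pK2 bK2.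
rewrite -nd; apply: finishes_run rd _; apply: compose trout j.
rewrite SE eqs -Ipi -{1}hpi -residue_ren.
exact: ctrace_ren.
Qed.

End Splice.

(** * Paths of the forest *)

Section Paths.
Variables (Pr C : eqType) (P : seq (rule Pr C)).
Implicit Types (a h : atom Pr C) (r : rule Pr C) (K : config Pr C).
Implicit Types (delta : seq (step Pr C)) (cg cs : nat -> bool).

(* An inner node of the forest: the configuration in which the rule is applied,
   the rewritten constraint and its identifier, the rule, and the later steps. *)
Record node := Nd { n_conf : config Pr C; n_atom : atom Pr C; n_id : nat;
  n_rule : rule Pr C; n_rest : seq (step Pr C) }.

Definition at_node K delta K'' (x : node) : Prop :=
  exists delta0 K2, [/\ run P K delta0 (n_conf x), (n_atom x, n_id x) \in store (n_conf x),
    trans P (n_conf x) (Apply (n_id x) (n_rule x)) K2, run P K2 (n_rest x) K''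
  & delta = delta0 ++ Apply (n_id x) (n_rule x) :: n_rest x].

(** A head kept by propagation counts among its own descendants. A head removed by simplification is
    never applied to again, so colouring its identifier adds nothing. *)
Definition below (x : node) : nat :=
  nown true (fun p => p < size (body (n_rule x))) (pred1 (n_id x)) (n_rest x).

Lemma nown_mono cg cg' cs cs' delta :
  (forall p, cg p -> cg' p) -> (forall q, cs q -> cs' q) ->
  nown true cg cs delta <= nown true cg' cs' delta.
Proof.
elim: delta cg cg' cs cs' => //= s delta IH cg cg' cs cs' sg ss.
apply: leq_add.
  by case: s => //= q r; case: (cs q) (ss q) => // /(_ isT) ->.
apply: IH; case: s => [j|j n|q r] //= p; try exact: sg.
  by case: ifP => // _; [exact: ss | exact: sg].
by case: ifP => // _; [exact: sg | exact: ss].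
Qed.

Lemma at_node_cons K s K' delta K'' x : trans P K s K' ->
  at_node K' delta K'' x -> at_node K (s :: delta) K'' x.
Proof.
move=> st [d0 [K2 [rd hq st' rd' ->]]]; exists (s :: d0), K2; split=> //.
exact: run_cons st rd.
Qed.

Lemma branchP (l : option (repetition Pr C)) F sigma : branch (Node l F) sigma ->
  sigma = [:: l] \/ exists F1 t F2 sigma',
    [/\ F = F1 ++ t :: F2, sigma = l :: sigma' & branch t sigma'].
Proof.
move=> b; inversion b as [|l' F1 t F2 sigma' b']; first by left.
by right; exists F1, t, F2, sigma'.
Qed.

Lemma map_split (T1 : eqType) (T2 : Type) (f : T1 -> T2) s F1 t F2 :
  map f s = F1 ++ t :: F2 -> exists2 x, x \in s & t = f x.
Proof.
elim: s F1 => [|y s IH] [|t1 F1] //= [].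
  by move=> <- _; exists y; rewrite ?mem_head.
by move=> _ /IH[x xs ->]; exists x; rewrite // inE xs orbT.
Qed.

Lemma rcons_split (T : Type) (s : seq T) y F1 t F2 :
  rcons s y = F1 ++ t :: F2 -> t = y \/ exists F3, s = F1 ++ t :: F3.
Proof.
case/lastP: F2 => [|F2 z]; first by rewrite cats1 => /rcons_inj[_ ->]; left.
by rewrite -rcons_cons -rcons_cat => /rcons_inj[-> _]; right; exists F2.
Qed.

Notation btrue := (BI BTrue).

Lemma chr_occsP (G : seq (constr Pr C)) p a :
  (p, a) \in chr_occs G -> nth btrue G p = Chr a.
Proof.
rewrite mem_pmap => /mapP[[i c] /(nthP (0, btrue))[k]].
rewrite size_zip size_iota minnn => kG; rewrite nth_zip ?size_iota // nth_iota //.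
by case=> <- <- /=; case E : (nth btrue G k) => [//|a'] [-> ->].
Qed.

Lemma nth_unbump G1 (c : constr Pr C) G2 p : p != size G1 ->
  nth btrue (G1 ++ G2) (unbump (size G1) p) = nth btrue (G1 ++ c :: G2) p.
Proof.
move=> pG; rewrite !nth_cat /unbump; case: (ltngtP (size G1) p) pG => // [lt|gt] _.
  have -> : (p - true < size G1) = false by lia.
  by have -> : p - size G1 = (p - true - size G1).+1 by lia.
by rewrite subn0 gt.
Qed.

Lemma store_uniq K h h' q : wf_ids K ->
  (h, q) \in store K -> (h', q) \in store K -> h = h'.
Proof.
case/andP=> + _; elim: (store K) => //= -[h1 q1] s IH /andP[q1s us].
have mems h2 : (h2, q) \in s -> q \in map snd s by move=> hq; apply/mapP; exists (h2, q).
rewrite !inE => /orP[/eqP[-> qE]|hq] /orP[/eqP[-> qE']|hq'].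
- by [].
- by case/negP: q1s; rewrite -qE; exact: mems hq'.
- by case/negP: q1s; rewrite -qE'; exact: mems hq.
- exact: IH.
Qed.

(** [tl] holds the repetition at the leaf, and is empty when the leaf is a box. The bound [N] is
    what allows the strict decrease to be extended to a node above. *)
Definition path_nodes K delta K'' sigma N : Prop :=
  exists L tl, [/\ map (@rep_constr Pr C) (pmap id sigma) = map n_atom L ++ tl,
    size tl <= 1, all (fun x => `[< at_node K delta K'' x >]) L,
    all (fun x => below x < N) L & pairwise (fun x y => below y < below x) L].

Lemma path_nodes_cons K s K' delta K'' sigma N N' : trans P K s K' -> N <= N' ->
  path_nodes K' delta K'' sigma N -> path_nodes K (s :: delta) K'' sigma N'.
Proof.
move=> st le [L [tl [sE tl1 aL lL pL]]]; exists L, tl; split=> //.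
  by apply: sub_all aL => x /asboolP xa; apply/asboolP; exact: at_node_cons xa.
by apply: sub_all lL => x /leq_trans; apply.
Qed.

(** The tree of an occurrence only involves applications to its descendants, so their number bounds
    [below] at every inner node of that tree. *)
Lemma forest_paths K delta K'' : run P K delta K'' -> wf_ids K ->
  (forall a pos sigma, nth btrue (goal K) pos = Chr a ->
     branch (occ_tree delta a pos) sigma ->
     path_nodes K delta K'' sigma (nown true (pred1 pos) pred0 delta)) /\
  (forall h q i sigma, (h, q) \in store K -> branch (rep_tree delta h q i) sigma ->
     path_nodes K delta K'' sigma (nown true pred0 (pred1 q) delta)).
Proof.
elim=> {K delta K''}.
  move=> K _; split=> [a pos|h q i] sigma _ /branchP[->|].
  - by exists [::], [:: a].
  - by move=> [[|? ?] [? [? [? []]]]].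
  - by exists [::], [:: h].
  - by move=> [[|? ?] [? [? [? []]]]].
move=> K s K' delta K'' st rd IH wfK.
have [IHo IHr] := IH (trans_wf st wfK).
have unbump_bump j pos p : pos != j -> p == unbump j pos -> bump j p == pos.
  by move=> ne /eqP->; rewrite unbumpK ?inE.
have st0 := st.
case: st rd wfK IHo IHr st0 => {K s K' IH}
  [G1 b G2 St B n|G1 a0 G2 St B n|G S1 h0 q0 S2 B n r theta ra hE ent] rd wfK IHo IHr st.
- split=> [a pos|h q i] sigma /= inK br.
    have posN : pos != size G1.
      by apply/eqP => pE; move: inK; rewrite pE nth_cat ltnn subnn.
    apply: path_nodes_cons st _ (IHo a _ _ _ br); last by rewrite (nth_unbump (BI b) G2 posN).
    by apply: nown_mono => // p /=; exact: unbump_bump.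
  apply: path_nodes_cons st _ (IHr h q i _ inK br).
  exact: nown_mono.
- split=> [a pos|h q i] sigma /= inK br.
    move: br; case: eqVneq => [pE|posN] br.
      have aE : a0 = a by move: inK; rewrite pE nth_cat ltnn subnn /= => -[].
      rewrite -aE in br; apply: path_nodes_cons st _ (IHr a0 n 0 _ _ br).
        by apply: nown_mono => // q /= ->.
      by rewrite /= mem_head.
    apply: path_nodes_cons st _ (IHo a _ _ _ br); last by rewrite (nth_unbump (Chr a0) G2 posN).
    by apply: nown_mono => // p /=; exact: unbump_bump.
  apply: path_nodes_cons st _ (IHr h q i _ _ br).
    apply: nown_mono => // q' /= /eqP->; case: (eqVneq q n) => //= qn.
    have : q < n by apply: (allP (proj2 (andP wfK))); apply/mapP; exists (h, q).
    by rewrite qn ltnn.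
  by rewrite inE inK orbT.
split=> [a pos|h q i] sigma /= inK br.
  apply: path_nodes_cons st _ (IHo a _ _ _ br).
    apply: nown_mono => // p /= /eqP->.
    by rewrite ltnNge leq_addr /= addKn eqxx.
  by rewrite /= nth_cat ltnNge leq_addr /= addKn.
move: br; case: (eqVneq q0 q) => [qq|qN] br; last first.
  apply: path_nodes_cons st _ (IHr h q i _ _ br).
    apply: leq_trans (leq_addl _ _); exact: nown_mono.
  move: inK; rewrite mem_cat inE xpair_eqE [q == _]eq_sym (negbTE qN) andbF /=.
  by case: (is_simp r); rewrite mem_cat ?inE => /orP[->|->]; rewrite ?orbT.
set K := Config G _ B n in inK wfK st; set K' := Config _ _ _ _ in rd IHo IHr st.
pose x := Nd K h q r delta.
have xK : at_node K (Apply q0 r :: delta) K'' x.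
  exists [::], K'; split=> //=; first exact: run_nil.
  - by rewrite -qq.
  - by rewrite qq.
have head_path sigma' N : below x < N -> path_nodes K' delta K'' sigma' (below x) ->
    path_nodes K (Apply q0 r :: delta) K'' (Some (Rep h (Some q) i) :: sigma') N.
  move=> xN [L [tl [sE tl1 aL lL pL]]]; exists (x :: L), tl; split=> //=.
  - by rewrite sE.
  - apply/andP; split; first exact/asboolP.
    by apply: sub_all aL => y /asboolP ya; apply/asboolP; exact: at_node_cons ya.
  - by rewrite xN; apply: sub_all lL => y /ltn_trans; apply.
  - by rewrite lL.
case/branchP: br => [->|[F1 [t [F2 [sigma' [FE -> br]]]]]].
  by exists [::], [:: h].
apply: head_path.
  (* The application at [x] is counted for the identifier [q] but not in [below x]; hence the
     strictness. *)
  by rewrite /= add1n ltnS; apply: nown_mono => // p /= ->.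
have child ka : ka \in chr_occs (body r) -> branch (occ_tree delta ka.2 ka.1) sigma' ->
    path_nodes K' delta K'' sigma' (below x).
  case: ka => p a /= /chr_occsP pa br'.
  have pr : p < size (body r).
    by rewrite ltnNge; apply/negP => /(nth_default btrue); rewrite pa.
  have [|L [tl [sE tl1 aL lL pL]]] := IHo a p sigma' _ br'.
    by rewrite /= nth_cat pr.
  exists L, tl; split=> //; apply: sub_all lL => y yl; apply: leq_trans yl _.
  by apply: nown_mono => // p' /eqP->.
have box : branch (Node None [::]) sigma' -> path_nodes K' delta K'' sigma' (below x).
  move=> /branchP[->|[F0 [t0 [F3 [s0 [e _ _]]]]]]; first by exists [::], [::].
  by case: F0 e.
move: FE; case: ifP => [ns FE|_].
  have [tE|[F3 E3]] := rcons_split FE; last first.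
    have [ka kaB tE] := map_split (T1 := (nat * atom Pr C)%type) E3.
    by rewrite tE in br; exact: child kaB br.
  rewrite tE in br; have [|L [tl [sE tl1 aL lL pL]]] := IHr h q i.+1 sigma' _ br.
    by rewrite /= (negbTE ns).
  exists L, tl; split=> //; apply: sub_all lL => y yl; apply: leq_trans yl _.
  exact: nown_mono.
case FE: map => [|t0 F0].
  case: F1 => [[tE _]|t1 [|? ?] //]; apply: box; by rewrite tE.
rewrite -FE => E3; have [ka kaB tE] := map_split (T1 := (nat * atom Pr C)%type) E3.
by rewrite tE in br; exact: child kaB br.
Qed.

End Paths.

(** * Minimal computations *)

Section Minimal.
Variables (Pr C : eqType) (P : seq (rule Pr C)) (c0 : C) (U : seq C) (w : nat).
Hypothesis okP : forall r c, r \in P -> c \in body r -> ok_constr U w c.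
Implicit Types (a h : atom Pr C) (K : config Pr C) (delta : seq (step Pr C)).
Implicit Types (H : seq (bool * (seq C -> Prop))).

Lemma run_wf K delta K' : run P K delta K' -> wf_ids K -> wf_ids K'.
Proof. by elim=> // {K delta K'} K s K1 delta K2 st _ IH wfK; apply: IH; exact: trans_wf st wfK. Qed.

Lemma run_ok K delta K' : run P K delta K' -> ok_config U w K -> ok_config U w K'.
Proof.
by elim=> // {K delta K'} K s K1 delta K2 st _ IH okK; apply: IH; exact: (trans_ok okP st okK).
Qed.

Definition interface (x : node Pr C) : seq nat := vars_atom (n_atom x).
Definition state (x : node Pr C) := proj (interface x) (bstore (n_conf x)).
Definition flagged (x : node Pr C) i := nth 0 (interface x) i \in fv (bstore (n_conf x)).

Definition node_history K'' (x : node Pr C) H : Prop :=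
  exists theta Mo nout,
  [/\ [/\ perm_eq (content (n_conf x)) (Chr (n_atom x) :: Mo),
          renamed_apart P (n_conf x) (n_rule x), n_atom x = subst_atom theta (head (n_rule x))
        & entails (bstore (n_conf x)) (subst_eqs (head (n_rule x)) theta ++ guard (n_rule x))],
      ctrace P (interface x) (below x) (residue (n_atom x) (n_rule x))
        (subst_eqs (head (n_rule x)) theta) (state x) H,
      ctrace P (interface x) nout Mo (bstore (n_conf x)) (state x) (dual H),
      below x + nout = napply (n_rest x)
    & chain c0 U (size (interface x)) (state x) H
      /\ last_state (state x) H = proj (interface x) (bstore K'')].

(** The rest of the computation is coloured by descent from the rewritten constraint and decomposed;
    the two colours have dual views of one history. *)
Lemma node_historyP K delta K'' x : wf_ids K -> ok_config U w K -> final P K'' ->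
  at_node P K delta K'' x -> exists H, node_history K'' x H.
Proof.
case: x => K1 h q r rest wfK okK fin [d0 [K2 [/= rd hq st rd' _]]].
have wfK1 := run_wf rd wfK; have okK1 := run_ok rd okK.
have wfK2 := trans_wf st wfK1; have okK2 := trans_ok okP st okK1.
rewrite /node_history /interface /state /below /=.
inversion st as [| |G S1 h' q' S2 B n r' theta ra hE' ent K1E qE K2E].
subst q' r' h'.
have hE : h = subst_atom theta (head r).
  by apply: store_uniq wfK1 hq _; rewrite -K1E /= mem_cat mem_head orbT.
rewrite -hE in K1E K2E ra *; rewrite K1E.
pose cg p := p < size (body r); pose cs := pred1 q.
have idsN hq' : hq' \in S1 ++ S2 -> cs hq'.2 = false.
  move=> hq'S; apply/eqP => qq; move: wfK1; rewrite -K1E wf_idsE map_cat /=.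
  rewrite -cat1s uniq_catCA cat1s cons_uniq -map_cat => /andP[/andP[/negP[]]].
  by rewrite -qq; apply: map_f.
pose Mo := part false cg cs K2.
have Mi : part true cg cs K2 = residue h r.
  rewrite /part /residue -K2E /= sel_cat (@sel_const _ _ true); last first.
    by move=> p pr; rewrite /cg pr.
  rewrite (@sel_const _ _ false); last first.
    by move=> p _; rewrite /cg ltnNge leq_addr.
  rewrite cats0; congr (_ ++ _); case: (is_simp r).
    rewrite (@eq_in_filter _ _ pred0); first by rewrite filter_pred0.
    by move=> hq' /idsN /= ->.
  rewrite filter_cat /= eqxx.
  have fN S3 : {subset S3 <= S1 ++ S2} -> [seq hq <- S3 | cs hq.2 == true] = [::].
    move=> sS; rewrite (@eq_in_filter _ _ pred0); first by rewrite filter_pred0.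
    by move=> hq' /sS /idsN /= ->.
  rewrite fN; last by move=> y yS; rewrite mem_cat yS.
  rewrite fN; last by move=> y yS; rewrite mem_cat yS orbT.
  by [].
have bK2 : bstore K2 = subst_eqs (head r) theta ++ bstore K1 by rewrite -K2E -K1E.
have pM2 : perm_eq (content K2) (residue h r ++ Mo).
  by rewrite -Mi; exact: (perm_part true cg cs K2).
have pM1 : perm_eq (content K1) (Chr h :: Mo).
  move: pM2; rewrite -K1E -K2E /content /residue /= -!catA perm_cat2l.
  case: (is_simp r) => //= pG; rewrite map_cat /= -cat1s catA perm_catCA perm_cons.
  by rewrite -catA -map_cat.
have ra1 : renamed_apart P K1 r by rewrite -K1E.
have j := joint_fork pM1 ra1 hE pM2 bK2.
have SE := joint_stateE j.
(* The split of the store given by [joint_fork]. *)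
pose Bp o := if o : bool then subst_eqs (head r) theta else bstore K1.
have jt o : joint (vars_atom h) (proj (vars_atom h) (bstore K2)) (part o cg cs K2) (Bp o)
              (part (~~ o) cg cs K2) (Bp (~~ o)) K2.
  by rewrite -SE; case: o; rewrite /= Mi //; exact: joint_sym.
have [H [tr ch lE]] := decompose c0 okP rd' fin wfK2 okK2 jt.
have histT : hist true H = H.
  by rewrite /hist -[RHS]map_id; apply: eq_map => -[[]].
have histF : hist false H = dual H by apply: eq_map => -[[]].
exists H, theta, Mo, (nown false cg cs rest); split.
- by split=> //; rewrite -K1E.
- by have := tr true; rewrite histT Mi -SE.
- by have := tr false; rewrite histF -SE.
- exact: nown_total.
- by rewrite SE.
Qed.

Lemma nonempty_proj I (B : seq (builtin C)) :
  nonempty (proj I B) <-> ~ inconsistent B.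
Proof.
split=> [[s [v vB _]] inc|ninc]; first by have := inc v; rewrite vB.
apply: contrapT => ne; apply: ninc => v; apply/negP => vB; apply: ne.
by exists (map v I), v.
Qed.

Lemma size_vars_atom a : size (vars_atom a) <= arity a.
Proof.
case: a => p ts; rewrite /vars_atom /arity /=.
by elim: ts => //= t ts IH; rewrite size_cat; case: t => [x|c] /=; rewrite ?add1n ?add0n ?ltnS // leqW.
Qed.

Variables (K K'' : config Pr C) (delta : seq (step Pr C)).
Hypothesis finK : final P K''.
Hypotheses (wfK : wf_ids K) (okK : ok_config U w K).
Hypothesis minK : forall n, finishes P K n -> napply delta <= n.

Notation fl := `[< inconsistent (bstore K'') >].

(** With an inconsistent store, the computation could have stopped before this application. *)
Lemma state_nonempty x : at_node P K delta K'' x -> nonempty (state x).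
Proof.
move=> [d0 [K2 [rd _ _ _ dE]]]; apply/nonempty_proj => inc.
have : napply delta <= napply d0.
  by apply: minK; exists d0, (n_conf x); split=> //; left.
by rewrite dE /napply count_cat /=; lia.
Qed.

Lemma state_closed x : at_node P K delta K'' x ->
  eqclosed c0 U (size (interface x)) (state x).
Proof.
move=> [d0 [K2 [rd _ _ _ _]]]; apply: proj_eqclosed.
by apply/allP; case/andP: (run_ok rd okK).
Qed.

Lemma interface_size x : at_node P K delta K'' x -> size (interface x) <= w.
Proof.
move=> [d0 [K2 [rd hq _ _ _]]]; apply: leq_trans (size_vars_atom _) _.
have /allP/(_ (Chr (n_atom x))) := proj1 (andP (run_ok rd okK)).
rewrite mem_cat; have -> : Chr (n_atom x) \in [seq Chr hq.1 | hq <- store (n_conf x)].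
  by apply/mapP; exists (n_atom x, n_id x).
by rewrite orbT => /(_ isT)/andP[].
Qed.

(** Replacing the descendants of [x] by those of [y] yields a terminating computation in which
    [below y] stands in place of [below x], and the total cannot drop. For [x] strictly above [y] on
    a path this is absurd. *)
Lemma distinct_histories x y rho H : at_node P K delta K'' x -> at_node P K delta K'' y ->
  bijective rho -> n_atom x = subst_atom (ren C rho) (n_atom y) ->
  node_history K'' x H -> node_history K'' y H -> state x = state y ->
  (forall i, i < size (interface y) -> flagged x i = flagged y i) ->
  below x <= below y.
Proof.
move=> [d0 [K2 [rd _ _ _ dE]]] _ brho xy.
move=> [_ [Mo [nout [[pM _ _ _] _ tout nE _]]]].
move=> [theta [Mo' [_ [[pM' ra hE ent] tin _ _ _]]]] SE fE.
have fin : finishes P (n_conf x) (1 + (below y + nout)).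
  apply: (splice brho xy pM _ ra hE ent SE fE tin tout).
  by rewrite (perm_mem pM') mem_head.
have := minK (finishes_run rd fin).
by rewrite dE /napply count_cat /= -!/(napply _) -nE; lia.
Qed.

Definition ratom a b := exists2 rho : nat -> nat, bijective rho & a = subst_atom (ren C rho) b.

Lemma ratom_sym a b : ratom a b -> ratom b a.
Proof.
move=> [rho [rho' rK rK'] ->]; exists rho'; first by exists rho.
by rewrite subst_atom_comp subst_atom_id // => x _ /=; rewrite rK.
Qed.

Lemma ratom_trans a b c : ratom a b -> ratom b c -> ratom a c.
Proof.
move=> [rho brho ->] [rho' brho' ->]; exists (rho \o rho'); first exact: bij_comp.
by rewrite subst_atom_comp.
Qed.

Lemma ratom_size a b : ratom a b -> size (vars_atom a) = size (vars_atom b).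
Proof. by move=> [rho _ ->]; rewrite vars_atom_ren size_map. Qed.

(** On the r-equal inner nodes of a path the code is injective, because equal codes would contradict
    the decrease of [below]; the final 1 is the leaf. *)
Lemma path_nodes_count sigma N a : path_nodes P K delta K'' sigma N ->
  count (fun b => `[< ratom b a >]) (map (@rep_constr Pr C) (pmap id sigma))
    <= 2 * (2 ^ (w * (size U + w))) ^ w.+1 + 1.
Proof.
move=> [L [tl [-> tl1 aL _ pL]]]; rewrite count_cat.
apply: leq_add; last exact: leq_trans (count_size _ _) tl1.
rewrite count_map -size_filter; set L' := filter _ L.
have [k kw kE] : exists2 k, k <= w & forall x, at_node P K delta K'' x ->
    ratom (n_atom x) a -> size (interface x) = k.
  case EL : (size (vars_atom a) <= w).
    by exists (size (vars_atom a)) => // x _ /ratom_size.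
  (* If [a] has more than [w] variable occurrences, no node is r-equal to it and any [k] will do. *)
  exists 0 => // x /interface_size xw /ratom_size xa.
  by move: xw; rewrite /interface xa EL.
have ex x : exists c : code U w, at_node P K delta K'' x -> ratom (n_atom x) a ->
    exists2 H, node_history K'' x H
      & coded c0 k fl (state x) (flagged x) H c.
  have [[nx xa]|nh] := pselect (at_node P K delta K'' x /\ ratom (n_atom x) a); last first.
    (* [choice] needs a total function, so other nodes get a dummy code. *)
    have H0 : letter U w by apply: (encode c0 U w (fun=> false) (fun=> False)).
    exists (false, H0, nseq_tuple w H0); move=> nx xa; case: nh; split=> //.
  have [H nh] := node_historyP wfK okK finK nx.
  have [theta [Mo [nout [_ _ _ _ [ch lE]]]]] := nh.
  rewrite (kE x nx xa) in ch.
  have sz : sized k (state x) by rewrite -(kE x nx xa); exact: sized_proj.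
  have [|c cc] := coded_exists (fl := fl) kw (flagged x) sz (state_nonempty nx) ch.
    rewrite lE nonempty_proj; split=> [ni|/asboolPn //]; exact/asboolPn.
  by exists c => _ _; exists H.
have [f fP] := choice ex.
have L'P x y : at_node P K delta K'' x -> ratom (n_atom x) a ->
    at_node P K delta K'' y -> ratom (n_atom y) a -> f x = f y -> below x <= below y.
  move=> nx xa ny ya fxy.
  have [H hx cx] := fP x nx xa; have [H' hy cy] := fP y ny ya; rewrite fxy in cx.
  have szx : sized k (state x) by rewrite -(kE x nx xa); exact: sized_proj.
  have szy : sized k (state y) by rewrite -(kE y ny ya); exact: sized_proj.
  have clx : eqclosed c0 U k (state x) by rewrite -(kE x nx xa); exact: state_closed.
  have cly : eqclosed c0 U k (state y) by rewrite -(kE y ny ya); exact: state_closed.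
  have [SE HE fE] := coded_inj kw szx szy (state_nonempty nx) (state_nonempty ny) clx cly cx cy.
  rewrite -HE in hy; have [rho brho xy] := ratom_trans xa (ratom_sym ya).
  apply: (distinct_histories nx ny brho xy hx hy SE) => i.
  by rewrite (kE y ny ya) => ik; apply: fE; exact: leq_trans ik kw.
have uL : uniq (map f L').
  rewrite uniq_pairwise pairwise_map.
  pose Q : pred (node Pr C) :=
    fun x => `[< at_node P K delta K'' x /\ ratom (n_atom x) a >].
  have QL : all Q L'.
    rewrite all_filter; apply: sub_all aL => x /asboolP nx; apply/implyP => /asboolP xa.
    exact/asboolP.
  apply: (sub_in_pairwise (P := Q) _ QL (pairwise_filter _ pL)) => x y /asboolP[nx xa].
  move=> /asboolP[ny ya] /= yx; apply: contraTneq yx => fxy.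
  by rewrite -leqNgt; exact: L'P.
by rewrite -(size_map f) -(card_uniqP uL) (leq_trans (max_card _)) // card_code expnS mulnA.
Qed.

End Minimal.

(** * The bound *)

(** In the geometric sum, Q ^ 0 pays for the leaf and Q ^ (w + 2) for 2 Q ^ (w + 1), as Q is at
    least 2. For w = 0 both sides are 3. *)
Lemma repetition_bound_ge u w :
  2 * (2 ^ (w * (u + w))) ^ w.+1 + 1 <= repetition_bound u w.
Proof.
rewrite /repetition_bound; case: eqP => [->|/eqP w0]; first by rewrite mul0n expn0 exp1n.
have Q2 : 2 <= 2 ^ (w * (u + w)).
  by rewrite -[leqLHS]expn1 leq_exp2l // muln_gt0 addn_gt0 lt0n w0 orbT.
rewrite (expnM 2 (w * (u + w)) (w + 3)).
move: (2 ^ (w * (u + w))) Q2 => Q Q2; rewrite leq_divRL ?subn_gt0 //.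
have -> : w + 3 = w.+1 + 2 by rewrite addnS addSn.
rewrite expnD; have : Q <= Q ^ w.+1 by rewrite -[leqLHS]expn1 leq_exp2l.
by move: (Q ^ w.+1) => x Qx; rewrite -mulnn; nia.
Qed.

Section Main.
Variables (Pr C : eqType).
Implicit Types (P : seq (rule Pr C)) (G : seq (constr Pr C)) (t : tree Pr C).

Lemma branch_exists t : exists sigma, branch t sigma.
Proof.
move: t; fix IH 1 => -[l [|t F]]; first by exists [:: l]; exact: branch_leaf.
by have [sigma b] := IH t; exists (l :: sigma); apply: (@branch_node _ _ l [::]).
Qed.

(** A box is never a root, so every sc-computation contains a repetition and its maximum is
    attained. *)
Lemma root_labelled (delta : seq (step Pr C)) :
  (forall a pos, exists x F, occ_tree delta a pos = Node (Some x) F) /\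
  (forall h q i, exists x F, rep_tree delta h q i = Node (Some x) F).
Proof.
elim: delta => [|s delta [IHo IHr]]; first by split=> *; do 2 eexists.
split=> [a pos|h q i]; case: s => [j|j n|q' r] /=; try exact: IHo; try exact: IHr.
  by case: ifP => _; [exact: IHr | exact: IHo].
by case: ifP => _; [do 2 eexists | exact: IHr].
Qed.

Lemma branch_head x F (sigma : seq (option (repetition Pr C))) :
  branch (Node (Some x) F) sigma -> x \in pmap id sigma.
Proof.
by case/branchP=> [->|[F1 [t [F2 [sigma' [_ -> _]]]]]]; rewrite /= mem_head.
Qed.

Lemma bigmax_attained (T : eqType) (f : T -> nat) x (s : seq T) :
  exists2 y, y \in x :: s & \max_(z <- x :: s) f z = f y.
Proof.
elim: s x => [|y s IH] x; first by exists x; rewrite ?mem_head ?big_seq1.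
have [z zs e] := IH y; rewrite big_cons e /maxn; case: ifP => _.
  by exists z; rewrite // inE zs orbT.
by exists x; rewrite ?mem_head.
Qed.

Lemma sc_repetitive_exists sigma (x : repetition Pr C) : x \in pmap id sigma ->
  exists p, sc_repetitive p sigma.
Proof.
move=> xs; exists (\max_(y <- pmap id sigma) nb_r_equal sigma y); split.
  case E : (pmap id sigma) xs => [//|z s] _.
  by have [y ys ->] := bigmax_attained (nb_r_equal sigma) z s; exists y.
by move=> y ys; exact: leq_bigmax_seq.
Qed.

(** The uniform bound [N] makes the maximum over all sc-computations exist, without enumerating
    them. *)
Lemma forest_repetitive_exists (F : seq (tree Pr C)) N :
  (forall sigma, sc_computation F sigma ->
     (exists x, x \in pmap id sigma) /\ forall x, nb_r_equal sigma x <= N) ->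
  exists2 m, forest_repetitive m F & m <= N.
Proof.
move=> sc; pose p m := `[< exists2 sigma, sc_computation F sigma & sc_repetitive m sigma >].
have pN m : p m -> m <= N.
  by move=> /asboolP[sigma /sc[_ le] [[x _ <-] _]].
case: F => [|t F] in sc p pN *.
  exists 0 => //; split; first by right.
  by move=> m' sigma _ [[|? ?] [? [? []]]].
have ep : exists m, p m.
  have [sigma b] := branch_exists t.
  have scs : sc_computation (t :: F) sigma by exists [::], t, F.
  have [[x xs] _] := sc _ scs; have [m rm] := sc_repetitive_exists xs.
  by exists m; apply/asboolP; exists sigma.
case: (ex_maxnP ep pN) => m pm max; exists m; last exact: pN.
split; first by left; exact/asboolP.
move=> m' sigma lt scs rm; have : p m' by apply/asboolP; exists sigma.
by move/max; rewrite leqNgt lt.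
Qed.

Lemma ok_body P G r c : r \in P -> c \in body r ->
  ok_constr (undup (flatten (map (@csts_rule _ _) P) ++ flatten (map (@csts_constr _ _) G)))
    (max_arity P G) c.
Proof.
move=> rP cr; apply/andP; split.
  apply/allP => d dc; rewrite /= mem_undup mem_cat; apply/orP; left.
  apply/flatten_mapP; exists r => //; rewrite !mem_cat; apply/orP; right.
  by apply/orP; right; apply/flatten_mapP; exists c.
case: c cr => // a ar; rewrite leq_max; apply/orP; left.
apply: leq_trans (leq_bigmax_seq _ rP _) => //.
apply: (@leq_bigmax_seq _ _ xpredT (fun a => arity a) a) => //.
rewrite inE mem_pmap; apply/orP; right; apply/mapP.
by exists (Chr a).
Qed.

Lemma ok_init P G :
  ok_config (undup (flatten (map (@csts_rule _ _) P) ++ flatten (map (@csts_constr _ _) G)))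
    (max_arity P G) (init G).
Proof.
rewrite /init ok_configE cats0 andbT; apply/allP => c cG; apply/andP; split.
  apply/allP => d dc; rewrite /= mem_undup mem_cat; apply/orP; right.
  by apply/flatten_mapP; exists c.
case: c cG => // a aG; rewrite leq_max; apply/orP; right.
apply: (@leq_bigmax_seq _ _ xpredT (fun a => arity a) a) => //.
by rewrite mem_pmap; apply/mapP; exists (Chr a).
Qed.

End Main.

Theorem theorem21 (Pr C : eqType) (herbrand_nonempty : inhabited C)
    (P : seq (rule Pr C)) (G : seq (constr Pr C)) :
  (exists delta, terminating P G delta) <->
  (exists delta m,
     [/\ terminating P G delta,
         forest_repetitive m (forest G delta)
       & m <= repetition_bound (nb_constants P G) (max_arity P G)]).
Proof.
split=> [[delta0 term0]|[delta [m [term _ _]]]]; last by exists delta.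
have [c0] := herbrand_nonempty.
pose p n := `[< exists2 delta, terminating P G delta & napply delta = n >].
have ep : exists n, p n by exists (napply delta0); apply/asboolP; exists delta0.
case: (ex_minnP ep) => n /asboolP[delta [K rd fin] <-] min {n}.
have minK n : finishes P (init G) n -> napply delta <= n.
  move=> [d [K' [rd' fin' le]]]; apply: leq_trans le; apply: min.
  by apply/asboolP; exists d => //; exists K'.
have wf0 : wf_ids (init G) by [].
have [paths _] := forest_paths rd wf0.
have [|m fm le] := @forest_repetitive_exists _ _ (forest G delta)
    (repetition_bound (nb_constants P G) (max_arity P G)); last first.
  by exists delta, m; split=> //; exists K.
move=> sigma [F1 [t [F2 [FE br]]]].
have [[pos a] paG tE] := map_split (T1 := (nat * atom Pr C)%type) FE.
rewrite {}tE in br; split.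
  have [x [F tE]] := (root_labelled delta).1 a pos.
  by exists x; rewrite /= tE in br; exact: branch_head br.
move=> x; apply: leq_trans (repetition_bound_ge _ _).
have := path_nodes_count c0 (@ok_body _ _ P G) fin wf0 (ok_init P G) minK
  (rep_constr x) (paths _ _ _ (chr_occsP paG) br).
by rewrite count_map.
Qed.
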